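(* Let $\mathcal{H}$ be a finite-dimensional Hilbert space, let $G_1,\ldots,G_J$ be Hermitian operators on $\mathcal{H}$, and for $\theta=(\theta_1,\ldots,\theta_J)\in\mathbb{R}^J$ let $G(\theta)=\sum_{j=1}^J\theta_j G_j$ and $\rho(\theta)=e^{-G(\theta)}/\operatorname{Tr}[e^{-G(\theta)}]$. Then for all $i,j\in\{1,\ldots,J\}$ the Fisher--Bures information matrix of the family $(\rho(\theta))_{\theta\in\mathbb{R}^J}$ satisfies $$I^{\mathrm{FB}}_{ij}(\theta)=\tfrac12\operatorname{Tr}\big[\{\Phi_\theta(G_i),\Phi_\theta(G_j)\}\rho(\theta)\big]-\operatorname{Tr}[G_i\rho(\theta)]\operatorname{Tr}[G_j\rho(\theta)],$$ where $\{A,B\}=AB+BA$. Equivalently, $I^{\mathrm{FB}}_{ij}(\theta)=\operatorname{Re}\operatorname{Tr}[\Phi_\theta(G_i)\rho(\theta)\Phi_\theta(G_j)]-\operatorname{Tr}[G_i\rho(\theta)]\operatorname{Tr}[G_j\rho(\theta)]$.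
   Context: The ''high-peak tent'' probability density on $\mathbb{R}$ is $p(t)=\frac{2}{\pi}\ln|\coth(\pi t/2)|$. The quantum channel $\Phi_\theta$ is defined on operators $X$ on $\mathcal{H}$ by $\Phi_\theta(X)=\int_{\mathbb{R}}dt\,p(t)\,e^{-iG(\theta)t}Xe^{iG(\theta)t}$. For a differentiable family $(\sigma(\theta))_{\theta\in\mathbb{R}^J}$ of positive-definite density operators with spectral decomposition $\sigma(\theta)=\sum_k\lambda_k|k\rangle\langle k|$ (eigenvalues and eigenvectors depending on $\theta$), the Fisher--Bures information matrix is $I^{\mathrm{FB}}_{ij}(\theta)=\sum_{k,\ell}\frac{2}{\lambda_k+\lambda_\ell}\langle k|\partial_i\sigma(\theta)|\ell\rangle\langle\ell|\partial_j\sigma(\theta)|k\rangle$, where $\partial_i=\partial/\partial\theta_i$. *)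

(* Defs.v *)
From mathcomp Require Import all_boot all_order all_algebra.
From mathcomp Require Import all_classical all_reals all_analysis.
From mathcomp Require Import complex.
Set Implicit Arguments. Unset Strict Implicit. Unset Printing Implicit Defensive.
Import Order.TTheory GRing.Theory Num.Theory numFieldNormedType.Exports.
Local Open Scope ring_scope.
Local Open Scope complex_scope.

Section QDefs.
Variable R : realType.
Local Notation C := R[i].

Definition clim (u : nat -> C) : C :=
  Complex (limn (fun k => (complex.Re (u k) : R))) (limn (fun k => (complex.Im (u k) : R))).

Definition expm (n : nat) (A : 'M[C]_n) : 'M[C]_n :=
  \matrix_(a, b) clim (fun N => (\sum_(k < N) ((k`!)%:R)^-1 *: (A ^+ k)) a b).

Definition cintegral (f : R -> C) : C :=
  Complex (Rintegral (@lebesgue_measure R) setT (fun t => complex.Re (f t)))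
          (Rintegral (@lebesgue_measure R) setT (fun t => complex.Im (f t))).

Definition coth (x : R) : R := (expR x + expR (- x)) / (expR x - expR (- x)).

Definition tent (t : R) : R := 2 / pi * ln `|coth (pi * t / 2)|.

Definition Phi (n : nat) (G X : 'M[C]_n) : 'M[C]_n :=
  \matrix_(a, b) cintegral (fun t =>
     (tent t)%:C * (expm ((- 'i * t%:C) *: G) *m X *m expm (('i * t%:C) *: G)) a b).

Definition adjoint (n m : nat) (A : 'M[C]_(n, m)) : 'M[C]_(m, n) :=
  (map_mx (@conjc R) A)^T.

Definition herm_op (n : nat) (A : 'M[C]_n) : Prop := adjoint A = A.

Definition unitary_op (n : nat) (U : 'M[C]_n) : Prop :=
  adjoint U *m U = 1%:M /\ U *m adjoint U = 1%:M.

Definition Gtheta (n J : nat) (Gs : 'I_J -> 'M[C]_n) (th : 'I_J -> R) : 'M[C]_n :=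
  \sum_(j < J) (th j)%:C *: Gs j.

Definition gibbs (n J : nat) (Gs : 'I_J -> 'M[C]_n) (th : 'I_J -> R) : 'M[C]_n :=
  (\tr (expm (- Gtheta Gs th)))^-1 *: expm (- Gtheta Gs th).

Definition shift (J : nat) (th : 'I_J -> R) (i : 'I_J) (t : R) : 'I_J -> R :=
  fun k => th k + (if k == i then t else 0).

Definition pderiv (n J : nat) (F : ('I_J -> R) -> 'M[C]_n) (i : 'I_J)
  (th : 'I_J -> R) : 'M[C]_n :=
  \matrix_(a, b) Complex
     (derive1 (fun t => complex.Re (F (shift th i t) a b)) 0)
     (derive1 (fun t => complex.Im (F (shift th i t) a b)) 0).

(* Fisher--Bures information, computed in the spectral decomposition
   sigma(theta) = sum_k lam_k |k><k|, where |k> is the k-th column of U: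
   I_ij = sum_{k,l} 2/(lam_k+lam_l) <k|d_i sigma|l><l|d_j sigma|k>. *)
Definition fisher_bures (n J : nat) (F : ('I_J -> R) -> 'M[C]_n)
  (th : 'I_J -> R) (U : 'M[C]_n) (lam : 'I_n -> R) (i j : 'I_J) : C :=
  \sum_(k < n) \sum_(l < n)
     (2 / (lam k + lam l))%:C
     * (adjoint U *m pderiv F i th *m U) k l
     * (adjoint U *m pderiv F j th *m U) l k.

End QDefs.

(* Main.v *)
(* In an eigenbasis of rho, G(theta) is diagonal with eigenvalues m_k = - ln (Z lam_k), and Phi_theta
   multiplies the (k, l) entry by the Fourier transform of p at w = m_k - m_l. Expanding ln coth,
   p(t) = (4 / pi) sum_(k odd) exp(- k pi |t|) / k, this transform is 8 sum_(k odd) 1 / (k^2 pi^2 + w^2),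
   i.e. tanh(w / 2) / (w / 2) by the partial fraction expansion of tanh. On the other side the derivative
   of exp(- G) multiplies entries by a divided difference of exp, and
   (lam_k - lam_l) / (m_l - m_k) = (lam_k + lam_l) / 2 * tanh(w / 2) / (w / 2),
   so that d_i rho = - {Phi(G_i), rho} / 2 + Tr[G_i rho] rho; substituting this in the
   Fisher--Bures sum gives the formula. *)

Require Import Defs.
From mathcomp Require Import all_boot all_order all_algebra.
From mathcomp Require Import all_classical all_reals all_analysis.
From mathcomp Require Import measurable_realfun complex.
From mathcomp Require Import zify ring lra.
Set Implicit Arguments. Unset Strict Implicit. Unset Printing Implicit Defensive.
Import Order.TTheory GRing.Theory Num.Theory numFieldNormedType.Exports.
Local Open Scope ring_scope.
Local Open Scope classical_set_scope.
Local Open Scope complex_scope.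

(** * Partial fractions of tanh *)

Section TanhSeries.
Variable R : realType.
Implicit Types x y w a : R.

(** Three analytic points shape the argument. The tanh series comes from finite identities at powers
    of two, obtained by angle doubling, followed by a Tannery argument: the terms are dominated
    uniformly in n, and the tail after K terms is at most cosh(w/2)/K. Next, integrating the series
    of p against cos(wt) directly would call for a dominated exchange before p is known to be
    integrable. The factors 1 + cos(wt) and 1 + sin(wt) are nonnegative, so monotone convergence
    suffices; the value at w = 0 then yields both the integrability of p and its mass 1. Finally,
    G(theta) and G_i need not commute, so exp(-G) is differentiated through a quadratic remainder
    bound on each power, strong enough to be summed against 1/k!. On the algebraic side, the
    eigenbasis of rho is given from outside and not built from G, so G has to be diagonalized in
    that very basis. *)

Definition sinhR x : R := (expR x - expR (- x)) / 2.
Definition coshR x : R := (expR x + expR (- x)) / 2.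
Definition tanhR x : R := sinhR x / coshR x.

Lemma coshR_gt0 x : 0 < coshR x.
Proof. by rewrite divr_gt0// addr_gt0// expR_gt0. Qed.

Lemma sinhR_ge0 x : 0 <= x -> 0 <= sinhR x.
Proof. by move=> x0; rewrite divr_ge0// subr_ge0 ler_expR; lra. Qed.

Lemma cosh2_sinh2 x : coshR x ^+ 2 - sinhR x ^+ 2 = 1.
Proof.
have := expRxMexpNx_1 x; rewrite /coshR /sinhR.
by set p := expR x; set q := expR (- x) => pq; field: pq.
Qed.

Lemma sinhRD x y : sinhR (x + y) = sinhR x * coshR y + coshR x * sinhR y.
Proof. by rewrite /sinhR /coshR opprD !expRD; field. Qed.

Lemma coshRD x y : coshR (x + y) = coshR x * coshR y + sinhR x * sinhR y.
Proof. by rewrite /sinhR /coshR opprD !expRD; field. Qed.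

Lemma coshR_ge1 x : 1 <= coshR x.
Proof.
have c0 := coshR_gt0 x; have := cosh2_sinh2 x; have := sqr_ge0 (sinhR x).
by nra.
Qed.

Lemma is_derive_sinhR x : is_derive x 1 sinhR (coshR x).
Proof.
rewrite /sinhR /coshR; apply: is_derive_eq.
by rewrite /GRing.scale/=; field.
Qed.

Lemma is_derive_coshR x : is_derive x 1 coshR (sinhR x).
Proof.
rewrite /sinhR /coshR; apply: is_derive_eq.
by rewrite /GRing.scale/=; field.
Qed.

End TanhSeries.

(** * Limits along null sequences and a lower bound for the sine *)

Section Limits.
Variable R : realType.
Implicit Types x y w a : R.

(** A derivative at 0 read along a null sequence: the tanh series is reached along 2^-n, and its
    value at w = 0 along 1/(n+1). *)
Lemma is_derive_seq (f : R -> R) (d : R) (e : R^nat) :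
  is_derive (0 : R) 1 f d -> f 0 = 0 -> (forall n, e n != 0) ->
  e @ \oo --> 0 -> (fun n => f (e n) / e n) @ \oo --> d.
Proof.
move=> df f0 en0 e0; have [dv <-] := df.
have := dv; rewrite /derivable /derive => /cvg_ex[l] hl.
have e' : e @ \oo --> 0^'.
  move=> A /= [r r0 rA]; have /cvgrPdist_lt/(_ _ r0) := e0.
  by case=> N _ hN; exists N => // k /hN /= h; apply: rA.
rewrite (cvg_lim _ hl)//.
have := cvg_comp _ _ e' hl; apply: cvg_trans; apply: near_eq_cvg.
near=> n => /=; rewrite /GRing.scale/= addr0 mulr1 f0 subr0 mulrC//.
Unshelve. all: by end_near. Qed.

Lemma is_derive_seqZ (f : R -> R) (d c : R) (e : R^nat) :
  is_derive (0 : R) 1 f d -> f 0 = 0 -> (forall n, e n != 0) ->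
  e @ \oo --> 0 -> (fun n => f (c * e n) / e n) @ \oo --> c * d.
Proof.
move=> df f0 en0 e0.
apply: (@is_derive_seq (fun x => f (c * x))) => //; last by rewrite mulr0.
have df' : is_derive (c * 0) 1 f d by rewrite mulr0.
have dg : is_derive (0 : R) 1 (fun x => c * x) c.
  by apply: is_derive_eq; rewrite /GRing.scale/= mulr1.
rewrite mulrC; exact: (@is_derive1_comp _ f (fun x => c * x) 0 d c df' dg).
Qed.

(** A crude Jordan inequality, enough for domination. With x = 2y, the mean value theorem gives sin
    y >= y cos y, hence sin x >= 2 y cos^2 y = y (1 + cos x) >= y. *)
Lemma sin_ge_half x : 0 <= x <= pi / 2 -> x / 2 <= sin x.
Proof.
move=> /andP[x0 xpi].
have [->|xn0] := eqVneq x 0; first by rewrite mul0r sin0.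
have xp : 0 < x by rewrite lt_def xn0.
pose y := x / 2.
have [y0 ypi] : 0 < y /\ y <= pi / 4 by rewrite /y; split; lra.
have pi0 : 0 < pi :> R := pi_gt0 R.
have [c + ] := @MVT R sin cos 0 y y0 (fun x _ => is_derive_sin x)
  (continuous_subspaceT (@continuous_sin R)).
rewrite in_itv/= sin0 !subr0 => /andP[c0 cy] sy.
have coscy : cos y <= cos c.
  by rewrite leNgt ltr_cos ?in_itv/=; [rewrite -leNgt ltW | lra | lra].
have cosy0 : 0 <= cos y by apply: cos_ge0_pihalf; lra.
have -> : x = y *+ 2 by rewrite /y; lra.
rewrite sin_mulr2n sy -mulr_natr mulfK ?pnatr_eq0//.
have cos2 : cos (y *+ 2) = cos y ^+ 2 *+ 2 - 1 by rewrite cos_mulr2n.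
have : 0 <= cos (y *+ 2) by apply: cos_ge0_pihalf; rewrite /y; lra.
rewrite cos2 => h.
have : cos y ^+ 2 <= cos y * cos c by rewrite expr2 ler_wpM2l.
by nra.
Qed.
End Limits.

(** * Finite partial fractions of tanh at powers of two *)

Section TanhPartialFractions.
Variable R : realType.
Implicit Types x y w a : R.

(** For y > 0, the Poisson kernel of the unit disc at radius exp(-2y) and angle a. *)
Let g y a : R := sinhR (2 * y) / (coshR (2 * y) - cos a).

Lemma coshB_cos_ge0 y a : sinhR y != 0 -> 0 < coshR (2 * y) - cos a.
Proof.
move=> sy; have : 0 < sinhR y ^+ 2 by rewrite lt_def sqr_ge0 sqrf_eq0 sy.
have := cosh2_sinh2 y; have := cos_le1 a.
by rewrite mulr_natl mulr2n coshRD -!expr2; lra.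
Qed.

(** Since cos(pi - a) = - cos a, the two denominators multiply to cosh^2(2y) - cos^2 a, which is
    half of cosh(4y) - cos(2a), while the numerators add up to 2 sinh(2y) cosh(2y) = sinh(4y). *)
Let g_double y a : sinhR (2 * y) != 0 -> sinhR y != 0 ->
  2 * g (2 * y) (2 * a) = g y a + g y (pi - a).
Proof.
move=> s2y sy; have c1 := coshB_cos_ge0 a sy.
have c2 := coshB_cos_ge0 (pi - a) sy; have c3 := coshB_cos_ge0 (2 * a) s2y.
have cpa : cos (pi - a) = - cos a by rewrite cosB cospi sinpi; lra.
move: c1 c2 c3; rewrite /g !cpa.
have -> : cos (2 * a) = 2 * cos a ^+ 2 - 1.
  by rewrite mulr_natl cos_mulr2n mulr_natl.
rewrite (_ : 2 * (2 * y) = 2 * y + 2 * y); last by ring.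
rewrite sinhRD coshRD.
have := cosh2_sinh2 (2 * y).
move: (sinhR (2 * y)) (coshR (2 * y)) (cos a) => s c b cs c1 c2 c3.
have ss : s * s = c ^+ 2 - 1 by rewrite -expr2; lra.
move: c3; rewrite ss => c3.
by field; rewrite !gt_eqF//=; lra.
Qed.

Lemma sinhR_gt0 x : 0 < x -> 0 < sinhR x.
Proof. by move=> x0; rewrite divr_gt0// subr_gt0 ltr_expR; lra. Qed.

(* The half-angle recursion g(y,a) + g(y,pi-a) = 2 g(2y,2a) replaces the factorization of z^m + 1. *)
Lemma tanhR_sum n y : 0 < y ->
  (2 ^ n)%:R * tanhR (2 * (2 ^ n)%:R * y) =
  \sum_(j < 2 ^ n) sinhR (2 * y) /
     (coshR (2 * y) - cos ((2 * j + 1)%:R * pi / (2 * (2 ^ n)%:R))).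
Proof.
elim: n y => [|n IH] y y0.
  rewrite expn0 big_ord1 /= muln0 add0n !mul1r mulr1 cos_pihalf subr0.
  by [].
have s1 : sinhR y != 0 by rewrite gt_eqF ?sinhR_gt0.
have s2 : sinhR (2 * y) != 0 by rewrite gt_eqF ?sinhR_gt0//; lra.
have H0 : (2 ^ n)%:R != 0 :> R by rewrite pnatr_eq0 expn_eq0.
rewrite expnS natrM -mulrA.
rewrite (_ : 2 * (2 * (2 ^ n)%:R) * y = 2 * (2 ^ n)%:R * (2 * y)); last by ring.
rewrite IH; last by lra.
rewrite mulr_sumr.
have -> : (2 * 2 ^ n = 2 ^ n + 2 ^ n)%N by rewrite mul2n addnn.
(* Reversing the upper half pairs index j with 2^(n+1) - 1 - j, whose angle is pi minus that of
   j. *)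
rewrite big_split_ord/= [X in _ = _ + X](reindex_inj rev_ord_inj)/= -big_split/=.
apply: eq_bigr => j _; set a := _ * pi / _.
have := @g_double y (a / 2) s2 s1; rewrite /g.
rewrite (_ : 2 * (a / 2) = a); last by field.
move=> ->; congr (_ / (_ - cos _) + _ / (_ - cos _)).
  by rewrite /a; field; lra.
rewrite /a.
have -> : (2 * (2 ^ n + (2 ^ n - j.+1)) + 1)%:R = 4 * (2 ^ n)%:R - (2 * j + 1)%:R :> R.
  apply/eqP; rewrite eq_sym subr_eq -natrM -natrD; apply/eqP; congr (_%:R).
  by have := ltn_ord j; lia.
by field; lra.
Qed.

End TanhPartialFractions.

(** * The infinite tanh series, with an explicit error bound *)

Section TanhSeriesLimit.
Variable R : realType.
Implicit Types x y w a : R.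

Lemma coshB_cosE y a :
  coshR (2 * y) - cos (2 * a) = 2 * (sinhR y ^+ 2 + sin a ^+ 2).
Proof.
rewrite (_ : 2 * y = y + y); last by ring.
rewrite coshRD mulr_natl cos_mulr2n sin2cos2.
by have := cosh2_sinh2 y; lra.
Qed.

Lemma continuous_sinhR : continuous (@sinhR R).
Proof.
move=> x; apply/differentiable_continuous/derivable1_diffP.
by case: (is_derive_sinhR x).
Qed.

Lemma continuous_coshR : continuous (@coshR R).
Proof.
move=> x; apply/differentiable_continuous/derivable1_diffP.
by case: (is_derive_coshR x).
Qed.

Lemma coshR_le x y : 0 <= x -> x <= y -> coshR x <= coshR y.
Proof.
rewrite le_eqVlt => /predU1P[<-|x0]; first by rewrite /coshR oppr0 expR0; have := coshR_ge1 y; rewrite /coshR; lra.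
rewrite le_eqVlt => /predU1P[->//|xy].
have [c + E] := @MVT R _ _ x y xy (fun z _ => is_derive_coshR z)
  (continuous_subspaceT continuous_coshR).
rewrite in_itv/= => /andP[xc _]; rewrite -subr_ge0 E mulr_ge0 ?subr_ge0 ?(ltW xy)//.
by apply: sinhR_ge0; lra.
Qed.

Lemma sinhR0 : sinhR 0 = 0 :> R.
Proof. by rewrite /sinhR oppr0 subrr mul0r. Qed.

Lemma coshR0 : coshR 0 = 1 :> R.
Proof. by rewrite /coshR oppr0 expR0 divff// pnatr_eq0. Qed.

Lemma sinhR_le x : 0 <= x -> sinhR x <= x * coshR x.
Proof.
rewrite le_eqVlt => /predU1P[<-|x0]; first by rewrite sinhR0 mul0r.
have [c + E] := @MVT R _ _ 0 x x0 (fun z _ => is_derive_sinhR z)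
  (continuous_subspaceT continuous_sinhR).
rewrite in_itv/= => /andP[c0 cx]; move: E; rewrite sinhR0 !subr0 mulrC => ->.
by rewrite ler_pM2l// coshR_le// ltW.
Qed.

Definition oddpi (j : nat) : R := (2 * j + 1)%:R * pi.

Lemma oddpi_gt0 j : 0 < oddpi j.
Proof. by rewrite mulr_gt0 ?pi_gt0// ltr0n addn1. Qed.

(** Summand j of [tanhR_sum] at y = w / (4 * 2^n), divided by 2^n * w, its denominator turned into a
    sum of squares by [coshB_cosE]. *)
Let v w (n j : nat) : R := sinhR (w / 2 / 2 ^+ n) / 2 ^+ n
  / (2 * (sinhR (w / 4 / 2 ^+ n) ^+ 2 + sin (oddpi j / 4 / 2 ^+ n) ^+ 2)) / w.

Let vE w n : 0 < w -> tanhR (w / 2) / w = \sum_(j < 2 ^ n) v w n j.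
Proof.
move=> w0; have e0 : 0 < 2 ^+ n :> R by rewrite exprn_gt0.
have y0 : 0 < w / 4 / 2 ^+ n by rewrite !divr_gt0.
have := tanhR_sum n y0; rewrite natrX.
rewrite (_ : 2 * 2 ^+ n * (w / 4 / 2 ^+ n) = w / 2); last by field; rewrite gt_eqF.
move=> E.
have -> : tanhR (w / 2) / w = 2 ^+ n * tanhR (w / 2) / 2 ^+ n / w.
  by field; rewrite !gt_eqF.
rewrite E !mulr_suml; apply: eq_bigr => j _.
rewrite (_ : (2 * j + 1)%:R * pi / (2 * 2 ^+ n) = 2 * (oddpi j / 4 / 2 ^+ n)).
  rewrite coshB_cosE /v (_ : 2 * (w / 4 / 2 ^+ n) = w / 2 / 2 ^+ n).
    by rewrite [in RHS](mulrAC (sinhR _)).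
  by field; rewrite gt_eqF.
by rewrite /oddpi; field; rewrite gt_eqF.
Qed.

(** A bound summable in j and independent of n. The numerator is controlled by sinh x <= x cosh x
    and the denominator by [sin_ge_half], which applies because j < 2^n keeps the angle below pi/2.
    This gives 16 / ((2j+1) pi)^2, and pi >= 2 turns 16 / pi^2 into 4. *)
Let v_bounds w n j : 0 < w -> (j < 2 ^ n)%N ->
  0 <= v w n j <= coshR (w / 2) * (4 / (2 * j + 1)%:R ^+ 2).
Proof.
move=> w0 jn; have e0 : 0 < 2 ^+ n :> R by rewrite exprn_gt0.
have e1 : 1 <= 2 ^+ n :> R by rewrite exprn_ege1// ler1n.
have a0 := oddpi_gt0 j; have := @pi_ge2 R => pi2.
have J0 : 0 < (2 * j + 1)%:R :> R by rewrite ltr0n addn1.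
set E := 2 ^+ n in e0 e1 *.
have x0 : 0 < w / 2 / E by rewrite !divr_gt0.
have xw : w / 2 / E <= w / 2 by rewrite ler_pdivrMr// ler_peMr//; lra.
have sw : sinhR (w / 2 / E) <= w / 2 / E * coshR (w / 2).
  rewrite (le_trans (sinhR_le (ltW x0)))// ler_pM2l//; exact: coshR_le (ltW x0) xw.
have s0 := sinhR_ge0 (ltW x0).
have aE : oddpi j / 4 / E / 2 <= sin (oddpi j / 4 / E).
  apply: sin_ge_half; apply/andP; split; first by rewrite ltW// !divr_gt0.
  rewrite ler_pdivrMr// /oddpi -subr_ge0.
  rewrite (_ : _ - _ = pi * (2 * E - (2 * j + 1)%:R) / 4); last by field.
  rewrite divr_ge0// mulr_ge0 ?pi_ge0// subr_ge0 /E -natrX -natrM ler_nat; lia.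
have b0 : 0 < oddpi j / 4 / E / 2 by rewrite !divr_gt0.
have b0' : 0 < (oddpi j / 4 / E / 2) ^+ 2 by rewrite exprn_gt0.
have den : 2 * (oddpi j / 4 / E / 2) ^+ 2 <=
   2 * (sinhR (w / 4 / E) ^+ 2 + sin (oddpi j / 4 / E) ^+ 2).
  rewrite ler_pM2l// ler_wpDl ?sqr_ge0// ler_pXn2r// ?nnegrE ?(ltW b0)//.
  by rewrite (le_trans (ltW b0)).
have den0 : 0 < 2 * (sinhR (w / 4 / E) ^+ 2 + sin (oddpi j / 4 / E) ^+ 2).
  by apply: lt_le_trans den; rewrite mulr_gt0.
rewrite /v -/E; apply/andP; split.
  by do !apply: divr_ge0 => //; exact: ltW.
rewrite ler_pdivrMr// ler_pdivrMr//.
have C0 := coshR_gt0 (w / 2).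
apply: (@le_trans _ _ (w / 2 / E * coshR (w / 2) / E)).
  by rewrite ler_pM2r ?invr_gt0.
apply: (@le_trans _ _ (coshR (w / 2) * (4 / (2 * j + 1)%:R ^+ 2) * w *
   (2 * (oddpi j / 4 / E / 2) ^+ 2))); last first.
  rewrite ler_pM2l//; by do 2 apply: mulr_gt0 => //.
rewrite /oddpi; set J := (2 * j + 1)%:R in J0 *.
rewrite -subr_ge0 (_ : _ - _ =
    coshR (w / 2) * w / E ^+ 2 * ((pi ^+ 2 - 4) / 8)); last first.
  by field; rewrite !gt_eqF.
rewrite mulr_ge0// ?divr_ge0 ?mulr_ge0 ?exprn_ge0 ?(ltW w0) ?(ltW C0) ?(ltW e0)//.
by rewrite expr2; nra.
Qed.

Let v_cvg w j : 0 < w -> v w n j @[n --> \oo] --> 4 / (w ^+ 2 + oddpi j ^+ 2).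
Proof.
move=> w0; pose e n : R := (2 ^+ n)^-1.
have en0 n : e n != 0 by rewrite invr_eq0 expf_neq0// pnatr_eq0.
have ecvg : e @ \oo --> 0.
  have := @cvg_expr R 2^-1; rewrite ger0_norm ?invr_ge0// invf_lt1// ltr1n => /(_ isT).
  by apply: cvg_trans; apply: near_eq_cvg; near=> n; rewrite /e exprVn.
have ds : is_derive (0 : R) 1 (@sinhR R) 1.
  by have := is_derive_sinhR (0 : R); rewrite coshR0.
have dsin : is_derive (0 : R) 1 (@sin R) 1.
  by have := is_derive_sin (0 : R); rewrite cos0.
have l1 := @is_derive_seqZ R _ 1 (w / 2) e ds sinhR0 en0 ecvg.
have l2 := @is_derive_seqZ R _ 1 (w / 4) e ds sinhR0 en0 ecvg.
have l3 := @is_derive_seqZ R _ 1 (oddpi j / 4) e dsin (@sin0 R) en0 ecvg.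
have a0 := oddpi_gt0 j.
have d0 : 0 < w ^+ 2 + oddpi j ^+ 2 by rewrite addr_gt0// exprn_gt0.
have -> : 4 / (w ^+ 2 + oddpi j ^+ 2) = w / 2 * 1 *
    (2 * ((w / 4 * 1) * (w / 4 * 1) + (oddpi j / 4 * 1) * (oddpi j / 4 * 1)))^-1 / w.
  by field; rewrite !gt_eqF//= !expr2 -!mulrDr; lra.
have nz : 2 * ((w / 4 * 1) * (w / 4 * 1) + (oddpi j / 4 * 1) * (oddpi j / 4 * 1)) != 0.
  by rewrite gt_eqF// !mulr1 mulr_gt0// addr_gt0// mulr_gt0// divr_gt0.
set s1 := fun n => _ in l1; set s2 := fun n => _ in l2; set s3 := fun n => _ in l3.
suff -> : (fun n => v w n j) =
    (fun n => s1 n * (2 * (s2 n * s2 n + s3 n * s3 n))^-1 * w^-1).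
  apply: cvgM; last exact: cvg_cst.
  apply: cvgM => //; apply: cvgV => //; apply: cvgM; first exact: cvg_cst.
  by apply: cvgD; apply: cvgM.
apply/funext => n; rewrite /s1 /s2 /s3.
rewrite /v -![_ / 2 ^+ n]/(_ * e n) !expr2.
move: (sinhR (w / 2 * e n)) (sinhR (w / 4 * e n)) (sin _) => t1 t2 t3.
have E0 := en0 n.
have -> : 2 * (t2 / e n * (t2 / e n) + t3 / e n * (t3 / e n)) =
          2 * (t2 * t2 + t3 * t3) / (e n * e n) by field.
rewrite invf_div; congr (_ / w); rewrite [RHS]mulrA; congr (_ / _); field.
by [].
Unshelve. all: by end_near. Qed.

(** Telescoping: (2j+1)^2 exceeds 4j(j+1) by exactly 1, so each term is below 1/j - 1/(j+1). *)
Lemma sum_odd_sq_tail (K N : nat) : (0 < K)%N -> (K <= N)%N ->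
  \sum_(K <= j < N) 4 / (2 * j + 1)%:R ^+ 2 <= K%:R^-1 - N%:R^-1 :> R.
Proof.
move=> K0 KN; have := telescope_sumr (fun j => - (j%:R^-1 : R)) KN.
rewrite opprK addrC => <-.
rewrite [leRHS]big_nat [leLHS]big_nat; apply: ler_sum => j /andP[Kj _].
have j0 : 0 < j%:R :> R by rewrite ltr0n (leq_trans K0).
rewrite -natr1 natrD natrM.
rewrite -subr_ge0 (_ : _ - _ =
   (j%:R * (j%:R + 1) * (2 * j%:R + 1) ^+ 2)^-1); last first.
  by field; rewrite !gt_eqF//; lra.
by rewrite invr_ge0 !mulr_ge0//; try lra; rewrite exprn_ge0//; lra.
Qed.

(** Tannery's argument with K fixed: the terms from K on are bounded uniformly in n, and the first K
    converge one by one. The explicit error is kept so that w can later tend to 0. *)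
Let tanhR_div_bounds w K : 0 < w -> (0 < K)%N ->
  0 <= tanhR (w / 2) / w - \sum_(j < K) 4 / (w ^+ 2 + oddpi j ^+ 2)
    <= coshR (w / 2) / K%:R.
Proof.
move=> w0 K0.
have cv : (fun n => tanhR (w / 2) / w - \sum_(j < K) v w n j) @ \oo -->
   tanhR (w / 2) / w - \sum_(j < K) 4 / (w ^+ 2 + oddpi j ^+ 2).
  apply: cvgB; first exact: cvg_cst.
  by apply: cvg_big => [|j _]; [exact: add_continuous|exact: v_cvg].
have main : \forall n \near \oo,
    0 <= tanhR (w / 2) / w - \sum_(j < K) v w n j <= coshR (w / 2) / K%:R.
  near=> n.
  have Kn : (K <= 2 ^ n)%N.
    rewrite (@leq_trans n)//; last exact: ltnW (ltn_expl _ _).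
    by near: n; exact: nbhs_infty_ge.
  have -> : tanhR (w / 2) / w - \sum_(j < K) v w n j = \sum_(K <= j < 2 ^ n) v w n j.
    rewrite (vE n w0) -!(big_mkord xpredT (v w n)) (big_cat_nat (leq0n K) Kn)//=.
    by rewrite addrAC subrr add0r.
  apply/andP; split.
    by rewrite big_nat sumr_ge0// => j /andP[_ /(v_bounds w0)/andP[]].
  apply: (@le_trans _ _ (\sum_(K <= j < 2 ^ n) coshR (w / 2) * (4 / (2 * j + 1)%:R ^+ 2))).
    by rewrite big_nat [leRHS]big_nat ler_sum// => j /andP[_ /(v_bounds w0)/andP[]].
  rewrite -mulr_sumr ler_pM2l ?coshR_gt0//.
  by rewrite (le_trans (sum_odd_sq_tail K0 Kn))// gerBl invr_ge0.
apply/andP; split.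
  by apply: (cvgr_to_ge cv); near=> n; have /andP[] : 0 <= tanhR (w / 2) / w - \sum_(j < K) v w n j <= coshR (w / 2) / K%:R by near: n.
by apply: (cvgr_to_le cv); near=> n; have /andP[] : 0 <= tanhR (w / 2) / w - \sum_(j < K) v w n j <= coshR (w / 2) / K%:R by near: n.
Unshelve. all: by end_near. Qed.

(* tanhc w = tanh(w / 2) / w, continuously extended to 0. *)
Definition tanhc w : R := if w == 0 then 1 / 2 else tanhR (w / 2) / w.

Lemma is_derive_tanhR0 : is_derive (0 : R) 1 (@tanhR R) 1.
Proof.
have dc := is_derive_coshR (0 : R); have ds := is_derive_sinhR (0 : R).
have c0 : coshR 0 != 0 :> R by rewrite coshR0 oner_neq0.
rewrite /tanhR; apply: is_derive_eq.
by rewrite /GRing.scale/= sinhR0 coshR0 !(mulr0, mul0r, invr1, mulr1, add0r, oppr0, mul1r).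
Qed.

(** The case w = 0 is the limit along w = 1/(n+1). It contains Euler's sum of 1/(2j+1)^2, equal to
    pi^2/8, which normalizes the density. *)
Lemma tanhc_bounds w K : 0 <= w -> (0 < K)%N ->
  0 <= tanhc w - \sum_(j < K) 4 / (w ^+ 2 + oddpi j ^+ 2)
    <= coshR (w / 2) / K%:R.
Proof.
move=> w0 K0; rewrite /tanhc; case: eqVneq => [->|wn0]; last first.
  by apply: tanhR_div_bounds => //; rewrite lt_def wn0.
pose e n : R := n.+1%:R^-1.
have en0 n : e n != 0 by rewrite invr_eq0 pnatr_eq0.
have ecvg : e @ \oo --> 0 by exact: cvg_harmonic.
have l1 := @is_derive_seqZ R _ 1 (1 / 2) e is_derive_tanhR0
  (ltac:(by rewrite /tanhR sinhR0 mul0r)) en0 ecvg.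
rewrite mulr1 in l1.
have l2 j : (fun n => 4 / (e n ^+ 2 + oddpi j ^+ 2)) @ \oo --> 4 / (0 ^+ 2 + oddpi j ^+ 2).
  apply: cvgM; first exact: cvg_cst.
  apply: cvgV; first by rewrite expr0n/= add0r gt_eqF// exprn_gt0// oddpi_gt0.
  by apply: cvgD; [exact: cvgM | exact: cvg_cst].
have l3 : (fun n => coshR (e n / 2) / K%:R) @ \oo --> coshR (0 / 2) / K%:R.
  apply: cvgM; last exact: cvg_cst.
  have e2 : (fun n => e n / 2) @ \oo --> (0 / 2 : R) by apply: cvgM => //; exact: cvg_cst.
  exact: (cvg_comp _ _ e2 (@continuous_coshR (0 / 2))).
have l4 : (fun n => tanhR (1 / 2 * e n) / e n -
    \sum_(j < K) 4 / (e n ^+ 2 + oddpi j ^+ 2)) @ \oo -->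
   1 / 2 - \sum_(j < K) 4 / (0 ^+ 2 + oddpi j ^+ 2).
  by apply: cvgB => //; apply: cvg_big => [|j _]; [exact: add_continuous|exact: l2].
have b n : 0 <= tanhR (1 / 2 * e n) / e n -
    \sum_(j < K) 4 / (e n ^+ 2 + oddpi j ^+ 2) <= coshR (e n / 2) / K%:R.
  have -> : 1 / 2 * e n = e n / 2 by rewrite mul1r mulrC.
  by apply: tanhR_div_bounds => //; rewrite invr_gt0 ltr0n.
apply/andP; split.
  by apply: (cvgr_to_ge l4); near=> n; have /andP[] := b n.
by apply: (ler_cvg_to l4 l3); near=> n; have /andP[] := b n.
Unshelve. all: by end_near. Qed.

Lemma tanhcN w : tanhc (- w) = tanhc w.
Proof.
rewrite /tanhc oppr_eq0; case: eqVneq => // w0.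
have E : tanhR (- w / 2) = - tanhR (w / 2).
  by rewrite /tanhR /sinhR /coshR mulNr opprK -[in RHS]opprB; field; rewrite gt_eqF// addr_gt0// expR_gt0.
by rewrite E invrN mulrNN.
Qed.

Lemma cvg_tanhc w :
  (fun K => \sum_(j < K) 4 / (w ^+ 2 + oddpi j ^+ 2)) @ \oo --> tanhc w.
Proof.
wlog w0 : w / 0 <= w.
  move=> H; have [/H//|w0] := leP 0 w; rewrite -tanhcN -sqrrN; apply: H; lra.
have l : (fun K => tanhc w - coshR (w / 2) / K%:R) @ \oo --> tanhc w.
  rewrite -[X in _ --> X]subr0; apply: cvgB; first exact: cvg_cst.
  rewrite -(mulr0 (coshR (w / 2))); apply: cvgM; first exact: cvg_cst.
  rewrite -(cvg_shiftn 1); under eq_fun do rewrite addn1.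
  exact: cvg_harmonic.
apply: (squeeze_cvgr _ l (cvg_cst (tanhc w))).
near=> K; have K0 : (0 < K)%N by near: K; exact: nbhs_infty_gt.
by have := tanhc_bounds w0 K0; lra.
Unshelve. all: by end_near. Qed.

End TanhSeriesLimit.

(** * Fourier transform of the high-peak tent *)

Section TentIntegral.
Variable R : realType.
Implicit Types x w a q t : R.
Local Notation mu := (@lebesgue_measure R).

Let atanh_rem N x : R :=
  ln (1 + x) - ln (1 - x) - \sum_(j < N) 2 * x ^+ (2 * j + 1) / (2 * j + 1)%:R.

(** Removing the term of degree 2N+1 lowers the derivative by 2 x^(2N), which raises the exponent in
    x^(2N) / (1 - x^2) by two. The closed form lets the mean value theorem bound the remainder. *)
Let is_derive_atanh_rem N x : 0 <= x -> x < 1 ->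
  is_derive x 1 (atanh_rem N) (2 * x ^+ (2 * N) / (1 - x ^+ 2)).
Proof.
move=> x0 x1.
have d1 : 1 + x != 0 by rewrite gt_eqF//; lra.
have d2 : 1 - x != 0 by rewrite gt_eqF//; lra.
have d3 : 1 - x ^+ 2 != 0 by rewrite (_ : _ - _ = (1 + x) * (1 - x)) ?mulf_neq0//; ring.
elim: N => [|N IH].
  have -> : atanh_rem 0 = (fun x => ln (1 + x) - ln (1 - x)).
    by apply/funext => y; rewrite /atanh_rem big_ord0 subr0.
  have l1 : is_derive (1 + x) 1 (@ln R) (1 + x)^-1 by apply: is_derive1_ln; lra.
  have l2 : is_derive (1 - x) 1 (@ln R) (1 - x)^-1 by apply: is_derive1_ln; lra.
  have e1 : is_derive x 1 (fun y => 1 + y) 1.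
    by apply: is_derive_eq; ring.
  have e2 : is_derive x 1 (fun y => 1 - y) (-1).
    by apply: is_derive_eq; ring.
  have c1 : is_derive x 1 (fun y => ln (1 + y)) ((1 + x)^-1 * 1).
    exact: (@is_derive1_comp _ (@ln R) (fun y => 1 + y)).
  have c2 : is_derive x 1 (fun y => ln (1 - y)) ((1 - x)^-1 * -1).
    exact: (@is_derive1_comp _ (@ln R) (fun y => 1 - y)).
  apply: is_derive_eq.
  by rewrite muln0 expr0; field; rewrite d1 d2 d3.
have -> : atanh_rem N.+1 =
    (fun y => atanh_rem N y - 2 / (2 * N + 1)%:R * y ^+ (2 * N + 1)).
  apply/funext => y; rewrite /atanh_rem big_ord_recr/= opprD addrA.
  by congr (_ - _); rewrite mulrAC.
have e1 : is_derive x 1 (fun y : R => y ^+ (2 * N + 1)) ((2 * N + 1)%:R * x ^+ (2 * N)).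
  rewrite addn1; split; first exact: exprn_derivable.
  by rewrite exp_derive /GRing.scale/= mulr1.
have n0 : (2 * N + 1)%:R != 0 :> R by rewrite pnatr_eq0 addn1.
apply: is_derive_eq; rewrite /GRing.scale/=.
rewrite mulnS exprD; move: n0; move: ((2 * N + 1)%:R) => M n0.
by field; rewrite n0 d3.
Qed.

(** The mean value theorem on [0, q] bounds the remainder by 2 q^(2N+1) / (1 - q^2), a geometric
    sequence. *)
Lemma cvg_atanh_series q : 0 < q -> q < 1 ->
  (fun N => \sum_(j < N) 2 * q ^+ (2 * j + 1) / (2 * j + 1)%:R) @ \oo -->
  ln ((1 + q) / (1 - q)).
Proof.
move=> q0 q1.
have q2 : 0 < 1 - q ^+ 2 by rewrite expr2; nra.
have b N : 0 <= atanh_rem N q <= 2 * q / (1 - q ^+ 2) * (q ^+ 2) ^+ N.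
  have cont : {within `[0, q], continuous (atanh_rem N)}.
    apply: derivable_within_continuous => z; rewrite in_itv/= => /andP[z0 zq].
    by have [] := @is_derive_atanh_rem N z z0 (le_lt_trans zq q1).
  have dz z : z \in `]0, q[%R ->
      is_derive z 1 (atanh_rem N) (2 * z ^+ (2 * N) / (1 - z ^+ 2)).
    by rewrite in_itv/= => /andP[z0 zq]; apply: is_derive_atanh_rem; lra.
  have [c + E] := @MVT R _ _ 0 q q0 dz cont; rewrite in_itv/= => /andP[c0 cq].
  have r0 : atanh_rem N 0 = 0.
    rewrite /atanh_rem addr0 subr0 subrr sub0r big1 ?oppr0// => j _.
    by rewrite expr0n addn1/= mulr0 mul0r.
  move: E; rewrite r0 !subr0 => ->.
  have c2 : 0 < 1 - c ^+ 2 by rewrite expr2; nra.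
  apply/andP; split.
    by rewrite mulr_ge0 ?(ltW q0)// divr_ge0 ?(ltW c2)// mulr_ge0// exprn_ge0// ltW.
  rewrite -exprM.
  rewrite [leRHS](_ : _ = 2 * q * (q ^+ (2 * N) / (1 - q ^+ 2))); last by ring.
  rewrite [leLHS](_ : _ = 2 * q * (c ^+ (2 * N) / (1 - c ^+ 2))); last by ring.
  rewrite ler_pM2l; last by lra.
  apply: ler_pM; rewrite ?exprn_ge0 ?invr_ge0 ?(ltW c0) ?(ltW c2)//.
    by apply: lerXn2r; rewrite ?nnegrE ltW.
  by rewrite lef_pV2 ?posrE// lerD2l lerN2 lerXn2r ?nnegrE ?ltW.
have l : atanh_rem N q @[N --> \oo] --> 0.
  apply: (squeeze_cvgr _ (cvg_cst (0 : R))).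
    by near=> N; exact: b N.
  apply: cvg_geometric.
  by rewrite ger0_norm ?sqr_ge0//; lra.
rewrite ln_div ?posrE; [|lra..].
have -> : (fun N => \sum_(j < N) 2 * q ^+ (2 * j + 1) / (2 * j + 1)%:R) =
    (fun N => ln (1 + q) - ln (1 - q) - atanh_rem N q).
  by apply/funext => N; rewrite /atanh_rem; lra.
by rewrite -[X in _ --> X]subr0; apply: cvgB => //; exact: cvg_cst.
Unshelve. all: by end_near. Qed.

Definition tent_term t (j : nat) : R := 4 / oddpi R j * expR (- (oddpi R j * `|t|)).

(** With q = exp(-pi |t|), the absolute value of coth(pi t / 2) is (1 + q) / (1 - q). At t = 0 one
    would have q = 1, and the series diverges. *)
Lemma cvg_tent t : t != 0 -> (fun N => \sum_(j < N) tent_term t j) @ \oo --> tent t.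
Proof.
move=> t0; pose q := expR (- (pi * `|t|)).
have pt : 0 < pi * `|t| by rewrite mulr_gt0 ?pi_gt0// normr_gt0.
have q0 : 0 < q := expR_gt0 _.
have q1 : q < 1 by rewrite /q -expR0 ltr_expR; lra.
have -> : tent t = 2 / pi * ln ((1 + q) / (1 - q)).
  rewrite /tent; congr (_ * ln _).
  have -> : `|coth (pi * t / 2)| = `|coth (pi * `|t| / 2)|.
    have cN x : coth (- x) = - coth x.
      by rewrite /coth opprK addrC -[expR (- x) - _]opprB invrN mulrN.
    by case: (ger0P t) => // _; rewrite mulrN mulNr cN normrN.
  rewrite /q /coth.
  set x := pi * `|t| / 2.
  have -> : - (pi * `|t|) = - x - x by rewrite /x; lra.
  have x0 : 0 < x by rewrite divr_gt0.
  have ex := expRxMexpNx_1 x.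
  have lx : expR (- x) < expR x by rewrite ltr_expR; lra.
  have e0 := expR_gt0 (- x).
  rewrite expRD ger0_norm; last first.
    by apply: divr_ge0; [rewrite addr_ge0 ?expR_ge0|rewrite subr_ge0 ltW].
  have ex0 := expR_gt0 x.
  have -> : 1 + expR (- x) * expR (- x) = expR (- x) * (expR x + expR (- x)).
    by rewrite mulrDr [_ * expR x]mulrC ex.
  have -> : 1 - expR (- x) * expR (- x) = expR (- x) * (expR x - expR (- x)).
    by rewrite mulrBr [_ * expR x]mulrC ex.
  by field; rewrite !gt_eqF//= subr_gt0.
suff -> : (fun N => \sum_(j < N) tent_term t j) =
    (fun N => 2 / pi * \sum_(j < N) 2 * q ^+ (2 * j + 1) / (2 * j + 1)%:R).
  by apply: cvgM; [exact: cvg_cst|exact: cvg_atanh_series].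
apply/funext => N; rewrite mulr_sumr; apply: eq_bigr => j _.
rewrite /tent_term /q -expRM_natl /oddpi.
have n0 : (2 * j + 1)%:R != 0 :> R by rewrite pnatr_eq0 addn1.
have p0 : pi != 0 :> R by rewrite gt_eqF// pi_gt0.
rewrite (_ : (2 * j + 1)%:R * - (pi * `|t|) = - ((2 * j + 1)%:R * pi * `|t|)); last by ring.
move: n0 (expR _); move: ((2 * j + 1)%:R) => M n0 E.
by move: p0; move: (pi : R) => P p0; field; rewrite n0 p0.
Qed.

Let tent_cos w j t : R := tent_term t j * (1 + cos (w * t)).

Lemma tent_term_ge0 t j : 0 <= tent_term t j.
Proof. by rewrite mulr_ge0 ?expR_ge0// divr_ge0// ltW// oddpi_gt0. Qed.

Lemma cosD1_ge0 x : 0 <= 1 + cos x :> R.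
Proof. by have := cos_geN1 x; lra. Qed.

Lemma tent_ge0 t : 0 <= tent t :> R.
Proof.
have [->|t0] := eqVneq t 0.
  (* At 0 the conventions 1/0 = 0 and ln 0 = 0 give [tent 0 = 0], although the density has an
     infinite peak there. *)
  by rewrite /tent /coth mulr0 mul0r oppr0 subrr invr0 mulr0 normr0 ln0// mulr0.
by apply: (cvgr_to_ge (cvg_tent t0)); near=> N; apply: sumr_ge0 => j _; exact: tent_term_ge0.
Unshelve. all: by end_near. Qed.

Lemma continuous_tent_term j : continuous (tent_term ^~ j).
Proof.
move=> t; apply: cvgM; first exact: cvg_cst.
apply: (@cvg_comp _ _ _ (fun t : R => - (oddpi R j * `|t|)) (@expR R)); last exact: continuous_expR.
by apply: cvgN; apply: cvgM; [exact: cvg_cst|exact: norm_continuous].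
Qed.

Let continuous_tent_cos w j : continuous (tent_cos w j).
Proof.
move=> t; apply: cvgM; first exact: continuous_tent_term.
apply: cvgD; first exact: cvg_cst.
apply: (@cvg_comp _ _ _ (fun t : R => w * t) (@cos R)); last exact: continuous_cos.
by apply: cvgM; [exact: cvg_cst|exact: cvg_id].
Qed.

(* Half-line antiderivative of exp(- a t) (1 + cos (w t)); adding 1 keeps the integrand nonnegative, so that the
   monotone versions of the FTC and of term-by-term integration apply. *)
Let primitive w a t : R :=
  - (expR (- (a * t)) / a) + expR (- (a * t)) * (w * sin (w * t) - a * cos (w * t)) / (a ^+ 2 + w ^+ 2).

Let is_derive_primitive w a t : 0 < a ->
  is_derive t 1 (primitive w a) (expR (- (a * t)) * (1 + cos (w * t))).
Proof.
move=> a0.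
have d0 : 0 < a ^+ 2 + w ^+ 2 by rewrite ltr_wpDr ?sqr_ge0// exprn_gt0.
rewrite /primitive.
have c1 : is_derive t 1 (fun t => expR (- (a * t))) (expR (- (a * t)) * - a).
  have lin : is_derive t 1 (fun t => - (a * t)) (- a).
    by apply: is_derive_eq; rewrite /GRing.scale/= mulr1.
  exact: (@is_derive1_comp _ (@expR R) (fun t => - (a * t))).
have lin : is_derive t 1 (fun t => w * t) w.
  by apply: is_derive_eq; rewrite /GRing.scale/= mulr1.
have c2 : is_derive t 1 (fun t => sin (w * t)) (cos (w * t) * w).
  exact: (@is_derive1_comp _ (@sin R) (fun t => w * t)).
have c3 : is_derive t 1 (fun t => cos (w * t)) (- sin (w * t) * w).
  exact: (@is_derive1_comp _ (@cos R) (fun t => w * t)).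
apply: is_derive_eq; rewrite /GRing.scale/=.
by field; rewrite !gt_eqF.
Qed.

Let primitive_cvgy w a : 0 < a -> primitive w a t @[t --> +oo] --> 0.
Proof.
move=> a0.
have d0 : 0 < a ^+ 2 + w ^+ 2 by rewrite ltr_wpDr ?sqr_ge0// exprn_gt0.
pose M := 1 / a + (`|w| + a) / (a ^+ 2 + w ^+ 2).
have bd t : - (M * expR (- (a * t))) <= primitive w a t <= M * expR (- (a * t)).
  have -> : primitive w a t = (- (1 / a) +
      (w * sin (w * t) - a * cos (w * t)) / (a ^+ 2 + w ^+ 2)) * expR (- (a * t)).
    by rewrite /primitive; field; rewrite !gt_eqF.
  rewrite -ler_norml normrM (ger0_norm (expR_ge0 _)) ler_pM2r ?expR_gt0//.
  rewrite (le_trans (ler_normD _ _))// normrN (gtr0_norm (divr_gt0 _ a0))// lerD2l.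
  rewrite normrM (gtr0_norm (_ : 0 < (_ + _)^-1)) ?invr_gt0// ler_pM2r ?invr_gt0//.
  rewrite (le_trans (ler_normB _ _))// !normrM (gtr0_norm a0).
  by apply: lerD; [rewrite ler_piMr// sin_max|rewrite ler_piMr ?(ltW a0)// cos_max].
have e0 : expR (- (a * t)) @[t --> +oo] --> (0 : R).
  apply: (@cvg_comp _ _ _ (fun t => a * t) (fun x => expR (- x)) _ (pinfty_nbhs R)).
    exact: gt0_cvgMry.
  exact: cvgr_expR.
have Me : M * expR (- (a * t)) @[t --> +oo] --> (0 : R).
  by rewrite -[X in _ --> X](mulr0 M); apply: cvgM => //; exact: cvg_cst.
have Ne : - (M * expR (- (a * t))) @[t --> +oo] --> (0 : R).
  by rewrite -[X in _ --> X]oppr0; exact: cvgN.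
by apply: (squeeze_cvgr _ Ne Me); near=> t; exact: bd.
Unshelve. all: by end_near. Qed.

(** By evenness this is twice the half-line integral, which equals 4/a times - [primitive w a 0],
    that is 4/a times 1/a + a / (a^2 + w^2). *)
Let integral_tent_cos w j :
  (\int[mu]_t (tent_cos w j t)%:E =
   (8 / oddpi R j ^+ 2 + 8 / (w ^+ 2 + oddpi R j ^+ 2))%:E)%E.
Proof.
have a0 := oddpi_gt0 R j; set a := oddpi R j in a0 *.
rewrite ge0_symfun_integralT; last 3 first.
- by move=> t; rewrite mulr_ge0 ?tent_term_ge0 ?cosD1_ge0.
- exact: continuous_tent_cos.
- by move=> t; rewrite /tent_cos /tent_term/= normrN mulrN cosN.
rewrite -set_itvcy.
pose f t := 4 / a * (expR (- (a * t)) * (1 + cos (w * t))).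
pose F t := 4 / a * primitive w a t.
have dF t : is_derive t 1 F (f t).
  have := is_derive_primitive w t a0 => ?.
  by rewrite /F; apply: is_derive_eq.
have cF : continuous F.
  by move=> t; apply/differentiable_continuous/derivable1_diffP; case: (dF t).
have -> : (\int[mu]_(t in `[0%R, +oo[) (tent_cos w j t)%:E =
    \int[mu]_(t in `[0%R, +oo[) (f t)%:E)%E.
  apply: eq_integral => t; rewrite inE/= in_itv/= andbT => t0.
  by rewrite /tent_cos /tent_term ger0_norm// /f -/a; congr (_%:E); ring.
rewrite (@ge0_continuous_FTC2y R f F 0 0).
- rewrite /F /primitive mulr0 oppr0 expR0 mulr0 sin0 cos0 sub0e -EFinN -EFinM.
  congr (_%:E); have d0 : 0 < a ^+ 2 + w ^+ 2 by rewrite ltr_wpDr ?sqr_ge0// exprn_gt0.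
  by rewrite [w ^+ 2 + _]addrC; field; rewrite !gt_eqF.
- move=> t _; apply: mulr_ge0; first by apply: divr_ge0 => //; exact: ltW.
  by apply: mulr_ge0; [exact: expR_ge0|exact: cosD1_ge0].
- apply: continuous_subspaceT => t; rewrite /f.
  apply: cvgM; first exact: cvg_cst.
  apply: cvgM.
    apply: (@cvg_comp _ _ _ (fun t : R => - (a * t)) (@expR R)); last exact: continuous_expR.
    by apply: cvgN; apply: cvgM; [exact: cvg_cst|exact: cvg_id].
  apply: cvgD; first exact: cvg_cst.
  apply: (@cvg_comp _ _ _ (fun t : R => w * t) (@cos R)); last exact: continuous_cos.
  by apply: cvgM; [exact: cvg_cst|exact: cvg_id].
- rewrite -[X in _ --> X](mulr0 (4 / a)); apply: cvgM; first exact: cvg_cst.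
  exact: primitive_cvgy.
- by move=> t _; case: (dF t).
- by apply: cvg_at_right_filter; exact: cF.
- by move=> t _; rewrite derive1E; case: (dF t).
Qed.

(** A pointwise limit of continuous partial sums away from 0; the point 0, where they diverge, is
    split off. *)
Lemma measurable_tent : measurable_fun setT (@tent R).
Proof.
rewrite -(setD1K (I : [set: R] 0)); apply/measurable_funU => //.
  exact: measurableD.
split.
  exact: measurable_fun_set1.
apply: (@measurable_fun_cvg _ _ _ _ (fun N t => \sum_(j < N) tent_term t j)) => [N|t /= [_ /eqP t0]]; last exact: cvg_tent.
apply: measurable_funTS; apply: measurable_sum => j.
apply: measurable_funM; first exact: measurable_cst.
apply: measurableT_comp => //; apply: measurableT_comp => //.
by apply: measurable_funM; [exact: measurable_cst|exact: normr_measurable].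
Qed.

Lemma nneseries_EFin (u : R^nat) (l : R) :
  (fun N => \sum_(j < N) u j) @ \oo --> l -> (\sum_(0 <= j <oo) (u j)%:E = l%:E)%E.
Proof.
move=> ul; apply/cvg_lim => //.
under eq_fun do rewrite sumEFin big_mkord.
by apply: cvg_EFin => //; near=> n.
Unshelve. all: by end_near. Qed.

(** Monotone convergence, which only asks for nonnegative terms. The null set {0} is removed because
    the series represents [tent] only off 0. *)
Let integral_tentM (g : R -> R) : (forall t, 0 <= g t) -> continuous g ->
  (\int[mu]_t (tent t * g t)%:E =
   \sum_(0 <= j <oo) \int[mu]_t (tent_term t j * g t)%:E)%E.
Proof.
move=> g0 cg.
have mg : measurable_fun setT g by exact: continuous_measurable_fun.
have mf : measurable_fun setT (fun t : R => (tent t * g t)%:E).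
  by apply/measurable_EFinP; apply: measurable_funM => //; exact: measurable_tent.
have mt j D : measurable_fun D (fun t : R => (tent_term t j * g t)%:E).
  apply/measurable_EFinP; apply: measurable_funTS; apply: continuous_measurable_fun.
  by move=> t; apply: cvgM; [exact: continuous_tent_term|exact: cg].
have mD : measurable (setT `\ (0 : R)) by exact: measurableD.
rewrite -(integral_setD1 (r := 0%R))//; last exact: measurable_funTS.
transitivity (\int[mu]_(t in setT `\ (0%R:R)) (\sum_(0 <= j <oo) (tent_term t j * g t)%:E))%E.
  apply: eq_integral => t; rewrite inE/= => -[_ /eqP t0].
  apply/esym/nneseries_EFin; under eq_fun do rewrite -mulr_suml.
  by apply: cvgM; [exact: cvg_tent|exact: cvg_cst].
rewrite integral_nneseries//; last 2 first.
  by move=> j; exact: mt.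
  by move=> j t _; rewrite lee_fin mulr_ge0 ?tent_term_ge0.
by apply: eq_eseriesr => j _; rewrite integral_setD1.
Qed.

Let integral_tent1cos w :
  (\int[mu]_t (tent t * (1 + cos (w * t)))%:E = (1 + 2 * tanhc w)%:E)%E.
Proof.
rewrite integral_tentM; last 2 first.
- by move=> t; exact: cosD1_ge0.
- move=> t; apply: cvgD; first exact: cvg_cst.
  apply: (@cvg_comp _ _ _ (fun t : R => w * t) (@cos R)); last exact: continuous_cos.
  by apply: cvgM; [exact: cvg_cst|exact: cvg_id].
rewrite (eq_eseriesr (g := fun j =>
    (8 / oddpi R j ^+ 2 + 8 / (w ^+ 2 + oddpi R j ^+ 2))%:E)); last first.
  by move=> j _; exact: integral_tent_cos.
apply: nneseries_EFin.
(* The terms free of w sum to 2 tanhc 0 = 1, so the mass of the density also comes from the tanh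
   series. *)
have -> : 1 + 2 * tanhc w = 2 * tanhc 0 + 2 * tanhc w.
  by rewrite [tanhc 0]/tanhc eqxx; lra.
have -> : (fun N => \sum_(j < N) (8 / oddpi R j ^+ 2 + 8 / (w ^+ 2 + oddpi R j ^+ 2))) =
    (fun N => 2 * \sum_(j < N) 4 / (0 ^+ 2 + oddpi R j ^+ 2) +
              2 * \sum_(j < N) 4 / (w ^+ 2 + oddpi R j ^+ 2)).
  apply/funext => N; rewrite !mulr_sumr -big_split/=; apply: eq_bigr => j _.
  by rewrite expr0n/= add0r !mulrA -natrM.
by apply: cvgD; apply: cvgM; [exact: cvg_cst|exact: cvg_tanhc|exact: cvg_cst|exact: cvg_tanhc].
Qed.

(** Serves 1 + sin(wt), which is not even: folding the line at 0 makes the odd part cancel inside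
    the integrand. *)
Lemma ge0_integralT_fold (f : R -> R) : (forall t, 0 <= f t) -> continuous f ->
  (\int[mu]_t (f t)%:E = \int[mu]_(t in `[0%R, +oo[) (f t + f (- t))%:E)%E.
Proof.
move=> f0 cf.
have mf : measurable_fun setT f by exact: continuous_measurable_fun.
have mposnums : measurable [set x : R | 0 <= x] by rewrite -set_itvcy.
rewrite -(setUv [set x : R | 0 <= x]) ge0_integral_setU//= ; last 4 first.
- exact: measurableC.
- by apply/measurable_EFinP; rewrite setUv.
- by move=> x _; rewrite lee_fin.
- exact/disj_setPCl.
rewrite -set_itvcy// setCitvr integral_itv_bndo_bndc; last exact/measurable_EFinP/measurable_funTS.
rewrite -{2}oppr0 ge0_integration_by_substitutionNy//; last exact: continuous_subspaceT.
have mfN : measurable_fun setT (fun t : R => f (- t)).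
  apply: continuous_measurable_fun => t.
  by apply: (@cvg_comp _ _ _ (fun t : R => - t) f); [apply: cvgN; exact: cvg_id|exact: cf].
rewrite -ge0_integralD//=.
- by move=> t _; rewrite lee_fin.
- by apply/measurable_EFinP; exact: measurable_funTS.
- by move=> t _; rewrite lee_fin.
- by apply/measurable_EFinP; exact: measurable_funTS.
Qed.

Let integral_tent1sin w :
  (\int[mu]_t (tent t * (1 + sin (w * t)))%:E = 1)%E.
Proof.
have lin : continuous (fun t : R => w * t).
  by move=> t; apply: cvgM; [exact: cvg_cst|exact: cvg_id].
have csin : continuous (fun t : R => 1 + sin (w * t)).
  move=> t; apply: cvgD; first exact: cvg_cst.
  by apply: (@cvg_comp _ _ _ (fun t : R => w * t) (@sin R)); [exact: lin|exact: continuous_sin].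
have sin0 t : 0 <= 1 + sin (w * t) by have := sin_geN1 (w * t); lra.
(* The new integrand is [tent] itself, in a form that [integral_tent1cos] evaluates. After folding,
   the two integrands agree term by term because sin(wt) and sin(-wt) cancel. *)
transitivity (\int[mu]_t (tent t * (1 / 2 * (1 + cos (0 * t))))%:E)%E.
  have ccst : continuous (fun t : R => 1 / 2 * (1 + cos (0 * t))).
    rewrite (_ : (fun t => _) = cst 1); last by apply/funext => t; rewrite mul0r cos0 /=; lra.
    by move=> t; exact: cvg_cst.
  have cos0' t : 0 <= 1 / 2 * (1 + cos (0 * t)) :> R by rewrite mul0r cos0; lra.
  rewrite !integral_tentM//; apply: eq_eseriesr => j _.
  rewrite !ge0_integralT_fold; last 4 first.
  - by move=> t; rewrite mulr_ge0 ?tent_term_ge0.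
  - by move=> t; apply: cvgM; [exact: continuous_tent_term|exact: ccst].
  - by move=> t; rewrite mulr_ge0 ?tent_term_ge0.
  - by move=> t; apply: cvgM; [exact: continuous_tent_term|exact: csin].
  apply: eq_integral => t _; congr (_%:E).
  rewrite /tent_term normrN !mul0r cos0 mulrN sinN; move: (_ * expR _) => T; lra.
have -> : (fun t : R => (tent t * (1 / 2 * (1 + cos (0 * t))))%:E) =
    (fun t : R => (1 / 2)%:E * (tent t * (1 + cos (0 * t)))%:E)%E.
  by apply/funext => t; rewrite -EFinM mulrCA.
rewrite ge0_integralZl_EFin//; last 2 first.
- by move=> t _; rewrite lee_fin mulr_ge0 ?tent_ge0 ?cosD1_ge0.
- apply/measurable_EFinP; apply: measurable_funM; first exact: measurable_tent.
  by rewrite (_ : (fun t => _) = cst 2)//; apply/funext => t; rewrite mul0r cos0.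
by rewrite integral_tent1cos /tanhc eqxx -EFinM; congr (_%:E); lra.
Qed.

Lemma integrable_tent : mu.-integrable setT (EFin \o @tent R).
Proof.
apply/integrableP; split.
  by apply/measurable_EFinP; exact: measurable_tent.
apply: (@le_lt_trans _ _ (\int[mu]_t (tent t * (1 + cos (0 * t)))%:E)%E); last first.
  by rewrite integral_tent1cos ltry.
rewrite ge0_le_integral//=.
- by apply/measurable_EFinP; apply: measurableT_comp; [exact: normr_measurable|exact: measurable_tent].
- apply/measurable_EFinP; apply: measurable_funM; first exact: measurable_tent.
  by rewrite (_ : (fun t => _) = cst 2)//; apply/funext => t; rewrite mul0r cos0.
- by move=> t _; rewrite lee_fin mul0r cos0 ger0_norm ?tent_ge0//; have := tent_ge0 t; lra.
Qed.

Lemma integrable_tentM (g : R -> R) : measurable_fun setT g -> (forall t, `|g t| <= 1) ->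
  mu.-integrable setT (EFin \o (fun t => tent t * g t)).
Proof.
move=> mg g1; apply: (le_integrable _ _ _ integrable_tent) => //.
  by apply/measurable_EFinP; apply: measurable_funM => //; exact: measurable_tent.
by move=> t _; rewrite lee_fin normrM ler_piMr.
Qed.

Let measurable_lin w (h : R -> R) : continuous h -> measurable_fun setT (fun t : R => h (w * t)).
Proof.
move=> ch; apply: continuous_measurable_fun => t.
apply: (@cvg_comp _ _ _ (fun t : R => w * t) h); last exact: ch.
by apply: cvgM; [exact: cvg_cst|exact: cvg_id].
Qed.

Lemma integrable_tent_cos w : mu.-integrable setT (EFin \o (fun t => tent t * cos (w * t))).
Proof.
by apply: integrable_tentM => [|t]; [apply: measurable_lin; exact: continuous_cos|exact: cos_max].
Qed.

Lemma integrable_tent_sin w : mu.-integrable setT (EFin \o (fun t => tent t * sin (w * t))).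
Proof.
by apply: integrable_tentM => [|t]; [apply: measurable_lin; exact: continuous_sin|exact: sin_max].
Qed.

Let Rintegral_tent : \int[mu]_t tent t = 1 :> R.
Proof.
rewrite -[RHS](congr1 fine (integral_tent1sin 0)); congr fine.
by apply: eq_integral => t _; rewrite mul0r sin0 addr0 mulr1.
Qed.

(** With integrability established, the auxiliary 1 is removed by subtracting the mass. *)
Lemma Rintegral_tent_cos w : \int[mu]_t (tent t * cos (w * t)) = 2 * tanhc w :> R.
Proof.
have : \int[mu]_t (tent t + tent t * cos (w * t)) = 1 + 2 * tanhc w :> R.
  rewrite -[RHS](congr1 fine (integral_tent1cos w)); congr fine.
  by apply: eq_integral => t _; rewrite mulrDr mulr1.
rewrite RintegralD//; [|exact: integrable_tent|exact: integrable_tent_cos].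
by rewrite Rintegral_tent => /addrI.
Qed.

Lemma Rintegral_tent_sin w : \int[mu]_t (tent t * sin (w * t)) = 0 :> R.
Proof.
have : \int[mu]_t (tent t + tent t * sin (w * t)) = 1 + 0 :> R.
  rewrite addr0 -[RHS](congr1 fine (integral_tent1sin w)); congr fine.
  by apply: eq_integral => t _; rewrite mulrDr mulr1.
rewrite RintegralD//; [|exact: integrable_tent|exact: integrable_tent_sin].
by rewrite Rintegral_tent => /addrI.
Qed.

End TentIntegral.

(** * Matrix exponential and its derivative *)

Section ComplexLimits.
Variable R : realType.
Local Notation C := R[i].
Implicit Types (u v : nat -> C) (z w : C).

(** Componentwise, to match [clim]. As [limn] returns a value even for a divergent sequence,
    convergence has to be tracked separately. *)
Definition ccvg u z : Prop :=
  ((fun n => complex.Re (u n)) @ \oo --> complex.Re z) /\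
  ((fun n => complex.Im (u n)) @ \oo --> complex.Im z).

Lemma ccvg_clim u z : ccvg u z -> clim u = z.
Proof.
by case: z => x y [/= ux uy]; rewrite /clim (cvg_lim _ ux)// (cvg_lim _ uy).
Qed.

Lemma complex_ReD z w : complex.Re (z + w) = complex.Re z + complex.Re w.
Proof. by case: z w => ? ? [? ?]. Qed.

Lemma complex_ImD z w : complex.Im (z + w) = complex.Im z + complex.Im w.
Proof. by case: z w => ? ? [? ?]. Qed.

Lemma complex_ReM z w : complex.Re (z * w) =
  complex.Re z * complex.Re w - complex.Im z * complex.Im w.
Proof. by case: z w => ? ? [? ?]. Qed.

Lemma complex_ImM z w : complex.Im (z * w) =
  complex.Re z * complex.Im w + complex.Im z * complex.Re w.
Proof. by case: z w => ? ? [? ?]. Qed.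

Lemma ccvg_cst z : ccvg (fun=> z) z.
Proof. by split; exact: cvg_cst. Qed.

Lemma ccvgD u v z w : ccvg u z -> ccvg v w -> ccvg (fun n => u n + v n) (z + w).
Proof.
move=> [ur ui] [vr vi]; split.
  by rewrite complex_ReD (funext (fun n => complex_ReD (u n) (v n))); exact: cvgD.
by rewrite complex_ImD (funext (fun n => complex_ImD (u n) (v n))); exact: cvgD.
Qed.

Lemma ccvgM u v z w : ccvg u z -> ccvg v w -> ccvg (fun n => u n * v n) (z * w).
Proof.
move=> [ur ui] [vr vi]; split.
  by rewrite complex_ReM (funext (fun n => complex_ReM (u n) (v n))); apply: cvgB; exact: cvgM.
by rewrite complex_ImM (funext (fun n => complex_ImM (u n) (v n))); apply: cvgD; exact: cvgM.
Qed.

Lemma ccvg_sum (I : Type) (r : seq I) (u : I -> nat -> C) (z : I -> C) :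
  (forall i, ccvg (u i) (z i)) ->
  ccvg (fun n => \sum_(i <- r) u i n) (\sum_(i <- r) z i).
Proof.
move=> uz; elim: r => [|i r IH].
  by rewrite big_nil; under eq_fun do rewrite big_nil; exact: ccvg_cst.
by rewrite big_cons; under eq_fun do rewrite big_cons; exact: ccvgD.
Qed.

Lemma eq_ccvg u v z : u =1 v -> ccvg u z -> ccvg v z.
Proof. by move=> /funext ->. Qed.

Definition cexp_sum z (N : nat) : C := \sum_(k < N) (k`!%:R)^-1 * z ^+ k.

Lemma ccvg_exp_real (x : R) : ccvg (cexp_sum x%:C) (expR x)%:C.
Proof.
have E N : cexp_sum x%:C N = (series (exp_coeff x) N)%:C.
  rewrite /cexp_sum /series /= big_mkord rmorph_sum; apply: eq_bigr => k _.
  by rewrite /exp_coeff /= rmorphM rmorphXn/= fmorphV rmorph_nat mulrC.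
have ex := @is_cvg_series_exp_coeff R x.
apply: (eq_ccvg (fun N => esym (E N))); split => /=; last exact: cvg_cst.
exact: ex.
Qed.

(** Shaped like [cos_coeff] and [sin_coeff], so that Euler's formula already holds between partial
    sums. *)
Lemma imag_expE N : 'i ^+ N =
  ((~~ odd N)%:R * (-1) ^+ N./2) +i* ((odd N)%:R * (-1) ^+ N.-1./2) :> C.
Proof.
have even_case m : 'i ^+ m.*2 = ((-1) ^+ m)%:C :> C.
  by rewrite -mul2n exprM sqr_i rmorphXn/= rmorphN1.
case: (boolP (odd N)) => oN; last first.
  by rewrite -{1}(even_halfK oN) even_case mul1r mul0r.
have oN' : ~~ odd N.-1 by case: N oN.
rewrite -{1}(ltn_predK (odd_gt0 oN)) -{1}(even_halfK oN') exprS even_case.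
by apply/eqP; rewrite eq_complex/=; apply/andP; split; apply/eqP; ring.
Qed.

Lemma ccvg_exp_imag (x : R) : ccvg (cexp_sum ('i * x%:C)) (cos x +i* sin x).
Proof.
have E N : cexp_sum ('i * x%:C) N = series (cos_coeff x) N +i* series (sin_coeff x) N.
  rewrite /cexp_sum; elim: N => [|N IH]; first by rewrite big_ord0 /series/= !big_geq.
  rewrite big_ord_recr/= IH !seriesSr exprMn imag_expE.
  rewrite -rmorphXn/= -(rmorph_nat (real_complex R)) -fmorphV/=.
  rewrite /cos_coeff /sin_coeff/=.
  move: (_%:R * _ ^+ N./2) (_%:R * _ ^+ N.-1./2) (N`!%:R^-1) => p q r.
  by apply/eqP; rewrite eq_complex/=; apply/andP; split; apply/eqP; ring.
apply: (eq_ccvg (fun N => esym (E N))).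
have cc := @is_cvg_series_cos_coeff R x; have sc := @is_cvg_series_sin_coeff R x.
by split => /=; rewrite unlock.
Qed.

End ComplexLimits.

Section ExpDiag.
Variables (R : realType) (n : nat).
Local Notation C := R[i].
Implicit Types (A B U V : 'M[C]_n).

Lemma conj_diag_exp U V (d : 'rV[C]_n) k : U *m V = 1%:M -> V *m U = 1%:M ->
  (U *m diag_mx d *m V) ^+ k = U *m diag_mx (map_mx (fun z => z ^+ k) d) *m V.
Proof.
move=> UV VU; elim: k => [|k IH].
  have -> : map_mx (fun z => z ^+ 0) d = const_mx 1.
    by apply/matrixP => i j; rewrite !mxE expr0.
  by rewrite diag_const_mx mulmx1 UV.
rewrite exprSr IH -mulmxE !mulmxA -(mulmxA _ V U) VU mulmx1 -(mulmxA U) mulmx_diag.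
by congr (_ *m diag_mx _ *m _); apply/matrixP => i j; rewrite !mxE ord1 exprSr.
Qed.

Lemma conj_diagE U V (d : 'rV[C]_n) a b :
  (U *m diag_mx d *m V) a b = \sum_j U a j * d 0 j * V j b.
Proof.
rewrite mxE; apply: eq_bigr => j _; congr (_ * _).
by rewrite mul_mx_diag mxE.
Qed.

(** Convergence is asked of each eigenvalue only, so the same lemma serves the real exponents of the
    Gibbs state and the imaginary ones of the unitary evolution. *)
Lemma expm_diag U V (d e : 'rV[C]_n) : U *m V = 1%:M -> V *m U = 1%:M ->
  (forall j, ccvg (cexp_sum (d 0 j)) (e 0 j)) ->
  expm (U *m diag_mx d *m V) = U *m diag_mx e *m V.
Proof.
move=> UV VU de; apply/matrixP => a b; rewrite [LHS]mxE; apply: ccvg_clim.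
rewrite conj_diagE.
apply: (@eq_ccvg _ (fun N => \sum_j U a j * cexp_sum (d 0 j) N * V j b)).
  move=> N; rewrite summxE.
  under [RHS]eq_bigr do rewrite conj_diag_exp// mxE conj_diagE mulr_sumr.
  rewrite exchange_big/=; apply: eq_bigr => j _.
  rewrite /cexp_sum mulr_sumr mulr_suml; apply: eq_bigr => k _.
  by rewrite !mxE; ring.
apply: ccvg_sum => j; apply: ccvgM; last exact: ccvg_cst.
by apply: ccvgM; [exact: ccvg_cst|exact: de].
Qed.

End ExpDiag.

(** * A submultiplicative norm and second-order expansion of powers *)

Section MatrixNorm.
Variable R : realType.
Local Notation C := R[i].
Implicit Types (z w : C).

(* The l1 norm of (Re, Im) is submultiplicative and avoids square roots. *)
Definition cnorm1 z : R := `|complex.Re z| + `|complex.Im z|.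

Lemma cnorm1_ge0 z : 0 <= cnorm1 z.
Proof. exact: addr_ge0. Qed.

Lemma Re_le_cnorm1 z : `|complex.Re z| <= cnorm1 z.
Proof. by rewrite lerDl. Qed.

Lemma Im_le_cnorm1 z : `|complex.Im z| <= cnorm1 z.
Proof. by rewrite lerDr. Qed.

Lemma complex_ReN z : complex.Re (- z) = - complex.Re z.
Proof. by case: z. Qed.

Lemma complex_ImN z : complex.Im (- z) = - complex.Im z.
Proof. by case: z. Qed.

Lemma cnorm1D z w : cnorm1 (z + w) <= cnorm1 z + cnorm1 w.
Proof.
rewrite /cnorm1 complex_ReD complex_ImD addrACA.
by apply: lerD; exact: ler_normD.
Qed.

Lemma cnorm1M z w : cnorm1 (z * w) <= cnorm1 z * cnorm1 w.
Proof.
rewrite /cnorm1 complex_ReM complex_ImM.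
have h1 := ler_normB (complex.Re z * complex.Re w) (complex.Im z * complex.Im w).
have h2 := ler_normD (complex.Re z * complex.Im w) (complex.Im z * complex.Re w).
by rewrite mulrDr !mulrDl; move: h1 h2; rewrite !normrM; lra.
Qed.

Lemma cnorm1_realM (t : R) z : cnorm1 (t%:C * z) = `|t| * cnorm1 z.
Proof. by case: z => x y; rewrite /cnorm1/= !mul0r subr0 addr0 !normrM mulrDr. Qed.

Lemma cnorm1_sum (I : finType) (F : I -> C) :
  cnorm1 (\sum_i F i) <= \sum_i cnorm1 (F i).
Proof.
elim/big_ind2 : _ => [|x1 x2 y1 y2 h1 h2|//]; first by rewrite /cnorm1 !normr0 addr0.
by rewrite (le_trans (cnorm1D _ _))// lerD.
Qed.

Variable n : nat.
Implicit Types A B : 'M[C]_n.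

(** Submultiplicative, but the identity has norm n, whence the factor [mnorm 1%:M] in the bounds on
    powers. *)
Definition mnorm A : R := \sum_i \sum_j cnorm1 (A i j).

Lemma mnorm_ge0 A : 0 <= mnorm A.
Proof. by apply: sumr_ge0 => i _; apply: sumr_ge0 => j _; exact: cnorm1_ge0. Qed.

Lemma cnorm1_le_mnorm A i j : cnorm1 (A i j) <= mnorm A.
Proof.
rewrite /mnorm (bigD1 i)//= (bigD1 j)//= -addrA lerDl addr_ge0//.
  by apply: sumr_ge0 => k _; exact: cnorm1_ge0.
by apply: sumr_ge0 => k _; apply: sumr_ge0 => l _; exact: cnorm1_ge0.
Qed.

Lemma mnormD A B : mnorm (A + B) <= mnorm A + mnorm B.
Proof.
rewrite /mnorm -big_split/=; apply: ler_sum => i _; rewrite -big_split/=.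
by apply: ler_sum => j _; rewrite mxE cnorm1D.
Qed.

Lemma mnormZ (t : R) A : mnorm (t%:C *: A) = `|t| * mnorm A.
Proof.
rewrite /mnorm mulr_sumr; apply: eq_bigr => i _; rewrite mulr_sumr.
by apply: eq_bigr => j _; rewrite mxE cnorm1_realM.
Qed.

Lemma mnorm0 : mnorm (0 : 'M[C]_n) = 0.
Proof. by have := mnormZ 0 0; rewrite scaler0 normr0 mul0r. Qed.

Lemma mnormM A B : mnorm (A *m B) <= mnorm A * mnorm B.
Proof.
rewrite /mnorm mulr_suml; apply: ler_sum => i _.
rewrite mulr_suml.
apply: (@le_trans _ _ (\sum_j \sum_k cnorm1 (A i k) * cnorm1 (B k j))).
  apply: ler_sum => j _; rewrite mxE (le_trans (cnorm1_sum _))//.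
  by apply: ler_sum => k _; exact: cnorm1M.
rewrite exchange_big/=; apply: ler_sum => k _; rewrite -mulr_sumr.
rewrite ler_wpM2l ?cnorm1_ge0// [leRHS](bigD1 k)//= lerDl.
by apply: sumr_ge0 => l _; apply: sumr_ge0 => j _; exact: cnorm1_ge0.
Qed.

Lemma mnormX A k : mnorm (A ^+ k) <= mnorm (1%:M : 'M[C]_n) * mnorm A ^+ k.
Proof.
elim: k => [|k IH]; first by rewrite expr0 mulr1.
rewrite exprSr -mulmxE (le_trans (mnormM _ _))// exprSr mulrA.
by rewrite ler_wpM2r// mnorm_ge0.
Qed.

(* Coefficient of t in (A + t B)^k. *)
Fixpoint dpow A B k : 'M[C]_n :=
  if k is k'.+1 then A *m dpow A B k' + B *m A ^+ k' else 0.

(** Each bound feeds the next: both differences satisfy a recursion of the form A times the previous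
    error plus tB times the quantity bounded just before. The factor L = |A| + |B| gained at each
    step gives bounds whose sum against 1/k! is at most c exp(L). *)
Lemma mnorm_pow_expansion A B (t : R) k : `|t| <= 1 ->
  let c := mnorm (1%:M : 'M[C]_n) in
  let L := mnorm A + mnorm B in
  [/\ mnorm ((A + t%:C *: B) ^+ k) <= c * L ^+ k,
      mnorm ((A + t%:C *: B) ^+ k - A ^+ k) <= `|t| * (c * L ^+ k) &
      mnorm ((A + t%:C *: B) ^+ k - A ^+ k - t%:C *: dpow A B k) <=
        `|t| ^+ 2 * (c * L ^+ k)].
Proof.
move=> t1 c L.
have a0 := mnorm_ge0 A; have b0 := mnorm_ge0 B; have c0 : 0 <= c := mnorm_ge0 _.
have L0 : 0 <= L by rewrite addr_ge0.
have T0 : 0 <= `|t| by [].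
have P j : mnorm ((A + t%:C *: B) ^+ j) <= c * L ^+ j.
  rewrite (le_trans (mnormX _ _))// ler_wpM2l// lerXn2r ?nnegrE ?mnorm_ge0//.
  by rewrite (le_trans (mnormD _ _))// lerD2l mnormZ ler_piMl.
have X0 j : 0 <= c * L ^+ j by rewrite mulr_ge0// exprn_ge0.
have Q j : mnorm ((A + t%:C *: B) ^+ j - A ^+ j) <= `|t| * (c * L ^+ j).
  elim: j => [|j IH]; first by rewrite !expr0 subrr mnorm0 mulr1 mulr_ge0.
  have -> : (A + t%:C *: B) ^+ j.+1 - A ^+ j.+1 =
     A *m ((A + t%:C *: B) ^+ j - A ^+ j) + t%:C *: (B *m (A + t%:C *: B) ^+ j).
    rewrite !exprS -!mulmxE mulmxDl mulmxBr -scalemxAl.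
    by rewrite addrAC.
  rewrite (le_trans (mnormD _ _))// mnormZ.
  have := ler_wpM2l a0 IH; have := ler_wpM2l b0 (P j).
  have := mnormM A ((A + t%:C *: B) ^+ j - A ^+ j).
  have := mnormM B ((A + t%:C *: B) ^+ j).
  move=> h1 h2 h3 h4.
  have h5 := ler_wpM2l T0 (le_trans h1 h3).
  have -> : `|t| * (c * L ^+ j.+1) =
    mnorm A * (`|t| * (c * L ^+ j)) + `|t| * (mnorm B * (c * L ^+ j)).
    by rewrite exprS /L; ring.
  by apply: lerD => //; exact: le_trans h2 h4.
split => //.
elim: k => [|j IH]; first by rewrite !expr0 subrr scaler0 subrr mnorm0 mulr1 mulr_ge0// exprn_ge0.
have -> : (A + t%:C *: B) ^+ j.+1 - A ^+ j.+1 - t%:C *: dpow A B j.+1 =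
    A *m ((A + t%:C *: B) ^+ j - A ^+ j - t%:C *: dpow A B j) +
    t%:C *: (B *m ((A + t%:C *: B) ^+ j - A ^+ j)).
  rewrite !exprS -!mulmxE/= mulmxDl !mulmxBr -scalemxAl -scalemxAr.
  rewrite scalerDr scalerBr !opprD !addrA.
  rewrite -!addrA; congr (_ + _).
  by rewrite addrCA; congr (_ + _); rewrite addrCA.
rewrite (le_trans (mnormD _ _))// mnormZ.
have h1 := ler_wpM2l a0 IH; have h2 := ler_wpM2l b0 (Q j).
have h3 := mnormM A ((A + t%:C *: B) ^+ j - A ^+ j - t%:C *: dpow A B j).
have h4 := mnormM B ((A + t%:C *: B) ^+ j - A ^+ j).
have h5 := ler_wpM2l T0 (le_trans h4 h2).
have -> : `|t| ^+ 2 * (c * L ^+ j.+1) =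
  mnorm A * (`|t| ^+ 2 * (c * L ^+ j)) + `|t| * (mnorm B * (`|t| * (c * L ^+ j))).
  by rewrite (exprS L) /L; ring.
by apply: lerD => //; exact: le_trans h3 h1.
Qed.

End MatrixNorm.

(** * Differentiating the exponential series *)

Section ExpDerivative.
Variable R : realType.
Local Notation C := R[i].

Lemma exp_partial_le (c L : R) N : 0 <= c -> 0 <= L ->
  \sum_(k < N) (k`!%:R)^-1 * (c * L ^+ k) <= c * expR L.
Proof.
move=> c0 L0.
have -> : \sum_(k < N) (k`!%:R)^-1 * (c * L ^+ k) = c * series (exp_coeff L) N.
  rewrite /series/= big_mkord mulr_sumr; apply: eq_bigr => k _.
  by rewrite /exp_coeff/= mulrCA; congr (_ * _); exact: mulrC.
rewrite ler_wpM2l//; apply: nondecreasing_cvgn_le; last exact: is_cvg_series_exp_coeff.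
by apply: nondecreasing_series => k _ _; rewrite /exp_coeff/= divr_ge0// exprn_ge0.
Qed.

Lemma cvg_series_exp_dominated (u : nat -> R) (c L : R) : 0 <= c -> 0 <= L ->
  (forall k, `|u k| <= c * L ^+ k) ->
  cvgn (fun N => \sum_(k < N) (k`!%:R)^-1 * u k).
Proof.
move=> c0 L0 uL.
have -> : (fun N => \sum_(k < N) (k`!%:R)^-1 * u k) = series (fun k => (k`!%:R)^-1 * u k).
  by apply/funext => N; rewrite /series/= big_mkord.
apply: normed_cvg.
apply: (@series_le_cvg _ _ (fun k => c * exp_coeff L k)).
- by move=> k; exact: normr_ge0.
- by move=> k; rewrite mulr_ge0// /exp_coeff/= divr_ge0// exprn_ge0.
- move=> k; rewrite /exp_coeff/= normrM normfV normr_nat mulrC mulrA.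
  by rewrite ler_wpM2r ?invr_ge0.
- by apply: is_cvg_seriesZ; exact: is_cvg_series_exp_coeff.
Qed.

Lemma complex_ReZ (r : R) (z : C) : complex.Re (r%:C * z) = r * complex.Re z.
Proof. by case: z => x y /=; rewrite mul0r subr0. Qed.

Lemma complex_ImZ (r : R) (z : C) : complex.Im (r%:C * z) = r * complex.Im z.
Proof. by case: z => x y /=; rewrite mul0r addr0. Qed.

Lemma factC k : (k`!%:R : C)^-1 = ((k`!%:R)^-1 : R)%:C.
Proof. by rewrite fmorphV rmorph_nat. Qed.

Lemma complex_Re_sum (I : finType) (F : I -> C) : complex.Re (\sum_i F i) = \sum_i complex.Re (F i).
Proof. by elim/big_ind2 : _ => // x1 x2 y1 y2 <- <-; rewrite complex_ReD. Qed.

Lemma complex_Im_sum (I : finType) (F : I -> C) : complex.Im (\sum_i F i) = \sum_i complex.Im (F i).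
Proof. by elim/big_ind2 : _ => // x1 x2 y1 y2 <- <-; rewrite complex_ImD. Qed.

Definition fact_sum (u : nat -> C) N : C := \sum_(k < N) (k`!%:R)^-1 * u k.

Lemma Re_fact_sum u N : complex.Re (fact_sum u N) = \sum_(k < N) (k`!%:R)^-1 * complex.Re (u k).
Proof. by rewrite complex_Re_sum; apply: eq_bigr => k _; rewrite factC complex_ReZ. Qed.

Lemma Im_fact_sum u N : complex.Im (fact_sum u N) = \sum_(k < N) (k`!%:R)^-1 * complex.Im (u k).
Proof. by rewrite complex_Im_sum; apply: eq_bigr => k _; rewrite factC complex_ImZ. Qed.

Lemma ccvg_fact_sum (u : nat -> C) (c L : R) : 0 <= c -> 0 <= L ->
  (forall k, cnorm1 (u k) <= c * L ^+ k) -> ccvg (fact_sum u) (clim (fact_sum u)).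
Proof.
move=> c0 L0 uL; split => /=.
  have h : cvgn (fun N => \sum_(k < N) (k`!%:R)^-1 * complex.Re (u k)).
    by apply: (@cvg_series_exp_dominated (fun k => complex.Re (u k)) c L) => // k; apply: le_trans (uL k); rewrite lerDl.
  by rewrite (funext (Re_fact_sum u)).
have h : cvgn (fun N => \sum_(k < N) (k`!%:R)^-1 * complex.Im (u k)).
  by apply: (@cvg_series_exp_dominated (fun k => complex.Im (u k)) c L) => // k; apply: le_trans (uL k); rewrite lerDr.
by rewrite (funext (Im_fact_sum u)).
Qed.

Variable n : nat.
Implicit Types A B D : 'M[C]_n.

Lemma expm_ccvg A a b : ccvg (fact_sum (fun k => (A ^+ k) a b)) (expm A a b).
Proof.
have -> : expm A a b = clim (fact_sum (fun k => (A ^+ k) a b)).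
  rewrite mxE; congr clim; apply/funext => N; rewrite summxE.
  by apply: eq_bigr => k _; rewrite mxE.
apply: (ccvg_fact_sum (mnorm_ge0 1%:M) (mnorm_ge0 A)) => k.
exact: le_trans (cnorm1_le_mnorm _ _ _) (mnormX _ _).
Qed.

(** The second-order bounds on powers, summed against 1/k!, hold for every partial sum and pass to
    the limit. *)
Lemma expm_taylor1 A B a b (d : C) :
  ccvg (fact_sum (fun k => dpow A B k a b)) d ->
  exists K : R, forall t : R, `|t| <= 1 ->
    cnorm1 (expm (A + t%:C *: B) a b - expm A a b - t%:C * d) <= K * t ^+ 2.
Proof.
move=> cd; pose c := mnorm (1%:M : 'M[C]_n); pose L := mnorm A + mnorm B.
have c0 : 0 <= c := mnorm_ge0 _.
have L0 : 0 <= L by rewrite addr_ge0// mnorm_ge0.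
(* The factor 2 adds the bounds on the real and the imaginary part. *)
exists (2 * (c * expR L)) => t t1.
pose u k := ((A + t%:C *: B) ^+ k - A ^+ k - t%:C *: dpow A B k) a b.
have uE N : fact_sum u N = fact_sum (fun k => ((A + t%:C *: B) ^+ k) a b) N
    + (-1) * fact_sum (fun k => (A ^+ k) a b) N
    + (- t%:C) * fact_sum (fun k => dpow A B k a b) N.
  rewrite /fact_sum !mulr_sumr -!big_split/=; apply: eq_bigr => k _.
  by rewrite /u !mxE; ring.
have cu : ccvg (fact_sum u) (expm (A + t%:C *: B) a b - expm A a b - t%:C * d).
  apply: (eq_ccvg (fun N => esym (uE N))).
  rewrite -[X in _ + X - _]mulN1r -[- (_ * d)]mulNr.
  by apply: ccvgD; [apply: ccvgD|]; try apply: ccvgM;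
    try exact: ccvg_cst; try exact: expm_ccvg.
have u_le k : cnorm1 (u k) <= t ^+ 2 * c * L ^+ k.
  have [_ _] := mnorm_pow_expansion A B k t1; rewrite real_normK ?num_real// mulrA.
  exact: le_trans (cnorm1_le_mnorm _ _ _).
have bound (f : C -> R) (fsum : forall N, f (fact_sum u N) = \sum_(k < N) (k`!%:R)^-1 * f (u k)) N :
    (forall z, `|f z| <= cnorm1 z) -> `|f (fact_sum u N)| <= t ^+ 2 * (c * expR L).
  move=> fle; rewrite fsum (le_trans (ler_norm_sum _ _ _))//.
  rewrite mulrA; apply: (le_trans _ (exp_partial_le N (mulr_ge0 (sqr_ge0 t) c0) L0)).
  apply: ler_sum => k _; rewrite normrM normfV normr_nat ler_wpM2l ?invr_ge0//.
  exact: le_trans (fle _) (u_le _).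
have [ur ui] := cu.
have lim_le (f : R^nat) (l : R) : f @ \oo --> l ->
    (forall N, `|f N| <= t ^+ 2 * (c * expR L)) -> `|l| <= t ^+ 2 * (c * expR L).
  by move=> fl fb; apply: (cvgr_to_le (cvg_norm fl)); near=> N; exact: fb.
have r1 := lim_le _ _ ur (fun N => bound _ (Re_fact_sum u) N (@Re_le_cnorm1 R)).
have r2 := lim_le _ _ ui (fun N => bound _ (Im_fact_sum u) N (@Im_le_cnorm1 R)).
by rewrite /cnorm1; move: r1 r2; lra.
Unshelve. all: by end_near. Qed.

(** Dividing the remainder by t leaves at most K |t|. A derivative is thus read off a single
    estimate, without differentiating a series term by term. *)
Lemma is_derive_quadratic (f : R -> R) (d K : R) :
  (forall t, `|t| <= 1 -> `|f t - f 0 - t * d| <= K * t ^+ 2) ->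
  is_derive (0 : R) 1 f d.
Proof.
move=> fK.
have K0 : 0 <= K.
  by have := fK 1; rewrite normr1 lexx expr1n mulr1 => /(_ isT); apply: le_trans.
have h : h^-1 *: (f (h *: (1 : R) + 0) - f 0) @[h --> 0^'] --> d.
  apply/cvgrPdist_le => e e0; near=> h.
  have h0 : h != 0 by near: h; exact: nbhs_dnbhs_neq.
  have h1 : `|h| <= 1.
    near: h; apply: dnbhs0_le; exact: ltr01.
  (* The shift K + 1 keeps the quotient meaningful when K = 0. *)
  have h2 : `|h| <= e / (K + 1).
    near: h; apply: dnbhs0_le; rewrite divr_gt0//; lra.
  rewrite /GRing.scale/= mulr1 addr0.
  have -> : d - h^-1 * (f h - f 0) = - (h^-1 * (f h - f 0 - h * d)) by field.
  rewrite normrN normrM normfV.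
  have hp : 0 < `|h| by rewrite normr_gt0.
  rewrite ler_pdivrMl// (le_trans (fK _ h1))// -real_normK ?num_real//.
  rewrite expr2 mulrCA ler_pM2l//.
  move: h2; rewrite ler_pdivlMr; last by lra.
  by apply: le_trans; rewrite mulrC ler_pM2l//; lra.
split; first by apply/cvg_ex; exists d.
by apply/cvg_lim.
Unshelve. all: by end_near. Qed.

Lemma is_derive_expm A B a b (d : C) :
  ccvg (fact_sum (fun k => dpow A B k a b)) d ->
  is_derive (0 : R) 1 (fun t : R => complex.Re (expm (A + t%:C *: B) a b)) (complex.Re d) /\
  is_derive (0 : R) 1 (fun t : R => complex.Im (expm (A + t%:C *: B) a b)) (complex.Im d).
Proof.
move=> /expm_taylor1[K HK].
have A0 : A + (0 : R)%:C *: B = A by rewrite scale0r addr0.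
split; apply: (@is_derive_quadratic _ _ K) => t t1; rewrite A0; apply: le_trans (HK t t1).
  rewrite -complex_ReZ -!complex_ReN -!complex_ReD; exact: Re_le_cnorm1.
rewrite -complex_ImZ -!complex_ImN -!complex_ImD; exact: Im_le_cnorm1.
Qed.

End ExpDerivative.

(** * Spectral decompositions *)

Section Adjoint.
Variable R : realType.
Local Notation C := R[i].

Lemma adjointM (m n p : nat) (A : 'M[C]_(m, n)) (B : 'M[C]_(n, p)) :
  adjoint (A *m B) = adjoint B *m adjoint A.
Proof. by rewrite /adjoint map_mxM trmx_mul. Qed.

Lemma adjointK (m n : nat) (A : 'M[C]_(m, n)) : adjoint (adjoint A) = A.
Proof. by apply/matrixP => i j; rewrite !mxE conjcK. Qed.

Lemma adjointD (m n : nat) (A B : 'M[C]_(m, n)) : adjoint (A + B) = adjoint A + adjoint B.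
Proof. by apply/matrixP => i j; rewrite !mxE rmorphD. Qed.

Lemma adjoint_realZ (m n : nat) (t : R) (A : 'M[C]_(m, n)) :
  adjoint (t%:C *: A) = t%:C *: adjoint A.
Proof. by apply/matrixP => i j; rewrite !mxE rmorphM/= oppr0. Qed.

Variable n : nat.
Implicit Types A B G U V : 'M[C]_n.

Definition real_diag (d : 'I_n -> R) : 'M[C]_n := diag_mx (\row_k (d k)%:C).

Lemma herm_opN A : herm_op A -> herm_op (- A).
Proof. by rewrite /herm_op => hA; rewrite -scaleN1r -(rmorphN1 (real_complex R)) adjoint_realZ hA. Qed.

(** The library's spectral theorem supplies complex eigenvalues; those of a Hermitian matrix are
    real, so taking real parts loses nothing. *)
Lemma herm_op_spectral G : herm_op G ->
  exists V, exists g : 'I_n -> R, unitary_op V /\ G = V *m real_diag g *m adjoint V.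
Proof.
move=> hG.
have hs : G \is hermsymmx.
  by apply/is_hermitianmxP; rewrite expr0 scale1r -map_trmx; exact: esym hG.
have uP := spectral_unitarymx G; set P := spectralmx G in uP.
have PE : map_mx Num.conj P^T = adjoint P by rewrite /adjoint map_trmx.
have G_eq : G = adjoint P *m diag_mx (spectral_diag G) *m P.
  have iP : invmx P = adjoint P by rewrite -PE; exact: invmx_unitary.
  have nG : G \is normalmx by apply: hermitian_normalmx.
  by rewrite -iP; apply/orthomx_spectralP.
exists (adjoint P), (fun k => complex.Re (spectral_diag G 0 k)).
have PP : P *m adjoint P = 1%:M by rewrite -PE; exact/unitarymxP.
split; first by split; rewrite adjointK//; exact: mulmx1C.
rewrite adjointK [LHS]G_eq; congr (_ *m diag_mx _ *m _).
apply/matrixP => i j; rewrite ord1 !mxE.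
by rewrite RRe_real//; have /mxOverP := hermitian_spectral_diag_real hs; apply.
Qed.

Lemma expm_real_diag U (d : 'I_n -> R) : unitary_op U ->
  expm (U *m real_diag d *m adjoint U) = U *m real_diag (expR \o d) *m adjoint U.
Proof.
move=> [UU1 UU2]; apply: expm_diag => // j; rewrite !mxE.
exact: ccvg_exp_real.
Qed.

Lemma mxtrace_conj U A : unitary_op U -> \tr (U *m A *m adjoint U) = \tr A.
Proof. by move=> [UU1 UU2]; rewrite mxtrace_mulC mulmxA UU1 mul1mx. Qed.

Lemma mxtrace_real_diag (d : 'I_n -> R) : \tr (real_diag d) = (\sum_k d k)%:C.
Proof.
by rewrite mxtrace_diag rmorph_sum; apply: eq_bigr => k _; rewrite mxE.
Qed.

(** A sum of exponentials of real eigenvalues. In dimension 0 it is an empty sum, so positivity is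
    conditional. *)
Lemma expm_herm_trace A : herm_op A ->
  exists2 z : R, \tr (expm A) = z%:C & ((0 < n)%N -> 0 < z).
Proof.
move=> /herm_op_spectral[V [g [hV ->]]].
rewrite expm_real_diag// mxtrace_conj// mxtrace_real_diag.
exists (\sum_k (expR \o g) k) => // n0.
rewrite (bigD1 (Ordinal n0))//= ltr_wpDr ?expR_gt0//.
by apply: sumr_ge0 => k _; exact: expR_ge0.
Qed.

(** Entrywise, W_kl can be nonzero only where a_k = b_l, and there f_k = h_l. This carries a
    function of the eigenvalues from one eigenbasis to another. *)
Lemma real_diag_intertwine (a b f h : 'I_n -> R) (W : 'M[C]_n) :
  real_diag a *m W = W *m real_diag b -> (forall k l, a k = b l -> f k = h l) ->
  real_diag f *m W = W *m real_diag h.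
Proof.
move=> WE fh; apply/matrixP => k l; have /matrixP/(_ k l) := WE.
rewrite !mul_diag_mx !mul_mx_diag !mxE.
have [->|W0] := eqVneq (W k l) 0; first by rewrite !mulr0 !mul0r.
by rewrite [in RHS]mulrC => /(mulIf W0) /complexI /fh ->; rewrite mulrC.
Qed.

(* An eigenbasis of exp(-G) diagonalizes the Hermitian G itself because exp is injective on the reals. *)
Lemma herm_op_log_diag G U (d : 'I_n -> R) : herm_op G -> unitary_op U ->
  (forall k, 0 < d k) -> expm (- G) = U *m real_diag d *m adjoint U ->
  G = U *m real_diag (fun k => - ln (d k)) *m adjoint U.
Proof.
move=> hG hU d0 expG; have [UU1 UU2] := hU.
have [V [g [hV GE]]] := herm_op_spectral hG; have [VV1 VV2] := hV.
have NGE : - G = V *m real_diag (fun k => - g k) *m adjoint V.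
  rewrite GE -mulNmx -mulmxN; congr (_ *m _ *m _).
  by apply/matrixP => i j; rewrite !mxE rmorphN mulNrn.
(* [W] relates an eigenbasis of [G] to the given one. It intertwines the exponentials, hence, after
   taking logarithms, the eigenvalues. *)
pose W := adjoint V *m U.
have WE : real_diag (fun k => expR (- g k)) *m W = W *m real_diag d.
  have : adjoint V *m expm (- G) *m U = W *m real_diag d.
    by rewrite expG /W -!mulmxA UU1 mulmx1.
  rewrite NGE expm_real_diag// => <-.
  by rewrite /W !mulmxA VV1 mul1mx.
have WgE : real_diag g *m W = W *m real_diag (fun k => - ln (d k)).
  by apply: real_diag_intertwine WE _ => k l <-; rewrite expRK opprK.
have GU : G *m U = U *m real_diag (fun k => - ln (d k)).
  rewrite GE -[V *m _ *m _ *m U]mulmxA -/W -mulmxA WgE /W !mulmxA VV2.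
  by rewrite mul1mx.
by rewrite -GU -mulmxA UU2 mulmx1.
Qed.

End Adjoint.

(** * Divided differences of powers and of exp *)

Section DividedDifference.
Variable R : realType.
Local Notation C := R[i].
Implicit Types x y : R.

(* Divided difference (x^k - y^k) / (x - y), without division. *)
Fixpoint hpow x y k : R := if k is k'.+1 then x * hpow x y k' + y ^+ k' else 0.

Lemma hpow_neq x y k : (x - y) * hpow x y k = x ^+ k - y ^+ k.
Proof.
elim: k => [|k IH] /=; first by rewrite mulr0 !expr0 subrr.
by rewrite mulrDr mulrCA IH !exprS; ring.
Qed.

Lemma hpow_eq x k : hpow x x k.+1 = k.+1%:R * x ^+ k.
Proof.
elim: k => [|k IH]; first by rewrite /= mulr0 add0r mul1r.
by rewrite [LHS]/= -/(hpow x x k.+1) IH exprS -[k.+2%:R]natr1; ring.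
Qed.

Definition expR_dd x y : R :=
  if x == y then expR x else (expR x - expR y) / (x - y).

Lemma ccvg_expR_dd x y :
  ccvg (fact_sum (fun k => (hpow x y k)%:C)) (expR_dd x y)%:C.
Proof.
rewrite /expR_dd; case: eqVneq => [<-|xy].
  have [er ei] := ccvg_exp_real x.
  (* The term k = 0 vanishes, and (k+1) x^k / (k+1)! = x^k / k!, so the series of exp reappears
     shifted by one index. *)
  have E N : fact_sum (fun k => (hpow x x k)%:C) N.+1 = cexp_sum x%:C N.
    rewrite /fact_sum big_ord_recl/= mulr0 add0r; apply: eq_bigr => k _.
    rewrite /bump leq0n add1n -/(hpow x x k.+1) hpow_eq factS natrM.
    rewrite rmorphM rmorphXn/= rmorph_nat invfM mulrACA.
    by rewrite mulVf ?mul1r// pnatr_eq0.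
  by split; rewrite -(cvg_shiftn 1); under eq_fun do rewrite addn1 E.
have xy0 : x - y != 0 by rewrite subr_eq0.
apply: (@eq_ccvg _ (fun N => ((x - y)^-1)%:C *
    (cexp_sum x%:C N + (-1) * cexp_sum y%:C N))).
  move=> N; rewrite /cexp_sum !mulr_sumr -big_split/= mulr_sumr.
  apply: eq_bigr => k _.
  have -> : hpow x y k = (x - y)^-1 * (x ^+ k - y ^+ k) by rewrite -hpow_neq mulKf.
  by rewrite rmorphM rmorphB !rmorphXn/=; ring.
have -> : ((expR x - expR y) / (x - y))%:C =
    ((x - y)^-1)%:C * ((expR x)%:C + (-1) * (expR y)%:C) :> C.
  by rewrite mulrC rmorphM rmorphB/= mulN1r.
apply: ccvgM; first exact: ccvg_cst.
apply: ccvgD; first exact: ccvg_exp_real.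
by apply: ccvgM; [exact: ccvg_cst|exact: ccvg_exp_real].
Qed.

End DividedDifference.

(** * The channel in an eigenbasis *)

Section PhiSpectral.
Variable R : realType.
Local Notation C := R[i].
Local Notation mu := (@lebesgue_measure R).

Definition cintegrable (f : R -> C) : Prop :=
  mu.-integrable setT (EFin \o (fun t => complex.Re (f t))) /\
  mu.-integrable setT (EFin \o (fun t => complex.Im (f t))).

Lemma integrable_linear (a b : R) (f g : R -> R) :
  mu.-integrable setT (EFin \o f) -> mu.-integrable setT (EFin \o g) ->
  mu.-integrable setT (EFin \o (fun t => a * f t + b * g t)).
Proof.
move=> hf hg.
have := integrableD measurableT (integrableZl measurableT a hf) (integrableZl measurableT b hg).
by apply: eq_integrable => // t _ /=; rewrite EFinD !EFinM.
Qed.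

Lemma Rintegral_linear (a b : R) (f g : R -> R) :
  mu.-integrable setT (EFin \o f) -> mu.-integrable setT (EFin \o g) ->
  Rintegral mu setT (fun t => a * f t + b * g t) =
  a * Rintegral mu setT f + b * Rintegral mu setT g.
Proof.
move=> hf hg; rewrite RintegralD//; last 2 first.
- by have := integrableZl measurableT a hf; apply: eq_integrable => // t _ /=; rewrite EFinM.
- by have := integrableZl measurableT b hg; apply: eq_integrable => // t _ /=; rewrite EFinM.
by rewrite !RintegralZl.
Qed.

Lemma cintegralZ (c : C) (f : R -> C) : cintegrable f ->
  cintegrable (fun t => c * f t) /\ cintegral (fun t => c * f t) = c * cintegral f.
Proof.
move=> [fr fi].
have Er : (fun t => complex.Re (c * f t)) =
    (fun t => complex.Re c * complex.Re (f t) + (- complex.Im c) * complex.Im (f t)).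
  by apply/funext => t; rewrite complex_ReM mulNr.
have Ei : (fun t => complex.Im (c * f t)) =
    (fun t => complex.Re c * complex.Im (f t) + complex.Im c * complex.Re (f t)).
  by apply/funext => t; rewrite complex_ImM.
split; first by split; rewrite ?Er ?Ei; exact: integrable_linear.
rewrite /cintegral Er Ei !Rintegral_linear//.
by case: c {Er Ei} => x y /=; rewrite mulNr.
Qed.

Lemma cintegralD (f g : R -> C) : cintegrable f -> cintegrable g ->
  cintegrable (fun t => f t + g t) /\
  cintegral (fun t => f t + g t) = cintegral f + cintegral g.
Proof.
move=> [fr fi] [gr gi].
have Er : (fun t => complex.Re (f t + g t)) =
    (fun t => 1 * complex.Re (f t) + 1 * complex.Re (g t)).
  by apply/funext => t; rewrite complex_ReD !mul1r.
have Ei : (fun t => complex.Im (f t + g t)) =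
    (fun t => 1 * complex.Im (f t) + 1 * complex.Im (g t)).
  by apply/funext => t; rewrite complex_ImD !mul1r.
split; first by split; rewrite ?Er ?Ei; exact: integrable_linear.
by rewrite /cintegral Er Ei !Rintegral_linear// !mul1r.
Qed.

Lemma cintegral0 : cintegrable (fun=> 0) /\ cintegral (fun=> 0 : C) = 0.
Proof.
split; first by split; exact: integrable0.
by rewrite /cintegral/= /Rintegral integral0.
Qed.

Lemma cintegral_sum (I : finType) (f : I -> R -> C) : (forall i, cintegrable (f i)) ->
  cintegral (fun t => \sum_i f i t) = \sum_i cintegral (f i).
Proof.
move=> hf; suff : forall s : seq I, cintegrable (fun t => \sum_(i <- s) f i t) /\
    cintegral (fun t => \sum_(i <- s) f i t) = \sum_(i <- s) cintegral (f i).
  by move=> /(_ (index_enum I))[].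
elim=> [|i s [IH1 IH2]].
  by rewrite big_nil; under eq_fun do rewrite big_nil; exact: cintegral0.
rewrite big_cons; under eq_fun do rewrite big_cons.
by have [? ->] := cintegralD (hf i) IH1; rewrite IH2.
Qed.

Lemma cintegral_tent (w : R) :
  let f := fun t : R => (tent t)%:C * (cos (w * t) +i* sin (w * t)) in
  cintegrable f /\ cintegral f = (2 * tanhc w)%:C.
Proof.
move=> f.
have Er : (fun t => complex.Re (f t)) = (fun t => tent t * cos (w * t)).
  by apply/funext => t; rewrite /f complex_ReZ.
have Ei : (fun t => complex.Im (f t)) = (fun t => tent t * sin (w * t)).
  by apply/funext => t; rewrite /f complex_ImZ.
rewrite /cintegrable /cintegral Er Ei; split.
  by split; [exact: integrable_tent_cos|exact: integrable_tent_sin].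
by rewrite Rintegral_tent_cos Rintegral_tent_sin.
Qed.

Variable n : nat.
Implicit Types G X U V T : 'M[C]_n.

Lemma mulmx3E U T V a b :
  (U *m T *m V) a b = \sum_(p : 'I_n * 'I_n) (U a p.1 * V p.2 b) * T p.1 p.2.
Proof.
rewrite mxE -(pair_bigA _ (fun k l => U a k * V l b * T k l))/= exchange_big/=.
apply: eq_bigr => l _; rewrite mxE mulr_suml; apply: eq_bigr => k _.
by rewrite mulrAC.
Qed.

Lemma expm_imag_diag U (d : 'I_n -> R) (s : R) : unitary_op U ->
  expm (('i * s%:C) *: (U *m real_diag d *m adjoint U)) =
  U *m diag_mx (\row_k (cos (s * d k) +i* sin (s * d k))) *m adjoint U.
Proof.
move=> [UU1 UU2].
have -> : ('i * s%:C) *: (U *m real_diag d *m adjoint U) =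
    U *m diag_mx (\row_k ('i * (s * d k)%:C)) *m adjoint U.
  rewrite scalemxAl scalemxAr; congr (_ *m _ *m _).
  by apply/matrixP => i j; rewrite !mxE rmorphM/= mulrA mulrnAr.
apply: expm_diag => // j; rewrite !mxE; exact: ccvg_exp_imag.
Qed.

Lemma Phi_spectral U (d : 'I_n -> R) X : unitary_op U ->
  Phi (U *m real_diag d *m adjoint U) X =
  U *m (\matrix_(k, l) ((2 * tanhc (d l - d k))%:C * (adjoint U *m X *m U) k l)) *m adjoint U.
Proof.
move=> hU; apply/matrixP => a b; rewrite [LHS]mxE mulmx3E.
set H := adjoint U *m X *m U.
pose f (p : 'I_n * 'I_n) (t : R) : C := (tent t)%:C *
  (cos ((d p.2 - d p.1) * t) +i* sin ((d p.2 - d p.1) * t)).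
pose c (p : 'I_n * 'I_n) : C := U a p.1 * adjoint U p.2 b * H p.1 p.2.
transitivity (cintegral (fun t => \sum_p c p * f p t)).
  congr cintegral; apply/funext => t.
  (* Reading -it as i(-t) lets [expm_imag_diag] treat both evolution factors. *)
  rewrite (_ : - 'i * t%:C = 'i * (- t)%:C); last by rewrite rmorphN mulNr mulrN.
  rewrite !expm_imag_diag// -!mulmxA.
  set E1 := diag_mx _; set E2 := diag_mx _.
  have -> : U *m (E1 *m (adjoint U *m (X *m (U *m (E2 *m adjoint U))))) =
      U *m (E1 *m H *m E2) *m adjoint U by rewrite /H !mulmxA.
  rewrite mulmx3E mulr_sumr; apply: eq_bigr => p _.
  rewrite /c /f /E1 /E2 mul_mx_diag mul_diag_mx !mxE -/(H p.1 p.2).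
  have -> : cos ((d p.2 - d p.1) * t) +i* sin ((d p.2 - d p.1) * t) =
     (cos (- t * d p.1) +i* sin (- t * d p.1)) * (cos (t * d p.2) +i* sin (t * d p.2)).
    rewrite (_ : (d p.2 - d p.1) * t = - t * d p.1 + t * d p.2); last by ring.
    apply/eqP; rewrite eq_complex/= cosD sinD eqxx/=; apply/eqP; ring.
  by ring.
rewrite cintegral_sum; last first.
  by move=> p; have [] := cintegralZ (c p) (cintegral_tent (d p.2 - d p.1)).1.
apply: eq_bigr => p _.
have [_ ->] := cintegralZ (c p) (cintegral_tent (d p.2 - d p.1)).1.
by rewrite (cintegral_tent _).2 [X in _ = _ * X]mxE mulrA mulrAC.
Qed.

End PhiSpectral.

(** * Gibbs states *)

Lemma derive1_ratio (R : realType) (Z f : R -> R) (dZ df : R) : Z 0 != 0 ->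
  is_derive (0 : R) 1 Z dZ -> is_derive (0 : R) 1 f df ->
  derive1 (fun t => (Z t)^-1 * f t) 0 = (Z 0)^-1 * df - dZ / Z 0 ^+ 2 * f 0.
Proof.
move=> Z0 hZ hf.
suff h : is_derive (0 : R) 1 (fun t => (Z t)^-1 * f t) ((Z 0)^-1 * df - dZ / Z 0 ^+ 2 * f 0).
  by rewrite derive1E derive_val.
by apply: is_derive_eq; rewrite /GRing.scale/=; field.
Qed.

Section GibbsDerivative.
Variables (R : realType) (n : nat).
Local Notation C := R[i].
Implicit Types A B G U V : 'M[C]_n.

(** The Daletskii-Krein formula for powers: in an eigenbasis of A, the recursion of [dpow] becomes
    that of [hpow] in each entry. *)
Lemma dpow_conj U V (a : 'I_n -> R) B k : U *m V = 1%:M -> V *m U = 1%:M ->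
  dpow (U *m real_diag a *m V) (U *m B *m V) k =
  U *m (\matrix_(p, q) (B p q * (hpow (a p) (a q) k)%:C)) *m V.
Proof.
move=> UV VU; elim: k => [|k IH].
  rewrite /= (_ : \matrix_(p, q) _ = 0) ?mulmx0 ?mul0mx//.
  by apply/matrixP => p q; rewrite !mxE mulr0.
rewrite /= IH conj_diag_exp// !mulmxA.
rewrite -![U *m _ *m V *m U]mulmxA VU !mulmx1 -!(mulmxA U) -mulmxDr -mulmxDl.
congr (_ *m (_ *m _)); apply/matrixP => p q.
rewrite mul_diag_mx mul_mx_diag !mxE rmorphD rmorphM rmorphXn/=.
by ring.
Qed.

Lemma ccvg_dpow U V (a : 'I_n -> R) B i j : U *m V = 1%:M -> V *m U = 1%:M ->
  ccvg (fact_sum (fun k => dpow (U *m real_diag a *m V) (U *m B *m V) k i j))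
    ((U *m (\matrix_(p, q) (B p q * (expR_dd (a p) (a q))%:C)) *m V) i j).
Proof.
move=> UV VU; rewrite mulmx3E.
apply: (@eq_ccvg _ (fun N => \sum_(p : 'I_n * 'I_n)
  (U i p.1 * V p.2 j * B p.1 p.2) * fact_sum (fun k => (hpow (a p.1) (a p.2) k)%:C) N)).
  move=> N; rewrite /fact_sum; under eq_bigr do rewrite mulr_sumr.
  rewrite exchange_big/=; apply: eq_bigr => k _.
  rewrite dpow_conj// mulmx3E mulr_sumr; apply: eq_bigr => p _.
  by rewrite mxE; ring.
apply: ccvg_sum => p; rewrite mxE mulrA.
by apply: ccvgM; [exact: ccvg_cst|exact: ccvg_expR_dd].
Qed.

Variables (J : nat) (Gs : 'I_J -> 'M[C]_n) (th : 'I_J -> R).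
Hypothesis herm_Gs : forall j, herm_op (Gs j).

Lemma herm_Gtheta (th' : 'I_J -> R) : herm_op (Gtheta Gs th').
Proof.
rewrite /Gtheta; elim/big_ind : _ => [|A B hA hB|j _].
- by apply/matrixP => i j; rewrite !mxE conjc0.
- by rewrite /herm_op adjointD hA hB.
- by rewrite /herm_op adjoint_realZ herm_Gs.
Qed.

Lemma Gtheta_shift i (t : R) : - Gtheta Gs (Defs.shift th i t) = - Gtheta Gs th + t%:C *: (- Gs i).
Proof.
rewrite scalerN -opprD; congr (- _); rewrite /Gtheta /Defs.shift.
under eq_bigr do rewrite rmorphD scalerDl.
rewrite big_split/=; congr (_ + _).
rewrite (bigD1 i)//= eqxx big1 ?addr0// => j /negPf ->.
by rewrite rmorph0 scale0r.
Qed.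

Lemma pderiv_gibbs i (D : 'M[C]_n) (z : R) : (0 < n)%N ->
  (forall a b, ccvg (fact_sum (fun k => dpow (- Gtheta Gs th) (- Gs i) k a b)) (D a b)) ->
  \tr (expm (- Gtheta Gs th)) = z%:C ->
  pderiv (gibbs Gs) i th =
    (z^-1)%:C *: D - (complex.Re (\tr D) / z ^+ 2)%:C *: expm (- Gtheta Gs th).
Proof.
move=> n0 hD trz.
have [E [EE E0 dE]] : exists E : R -> 'M[C]_n, [/\ forall t, expm (- Gtheta Gs (Defs.shift th i t)) = E t,
    E 0 = expm (- Gtheta Gs th) & forall a b,
    is_derive (0 : R) 1 (fun t : R => complex.Re (E t a b)) (complex.Re (D a b)) /\
    is_derive (0 : R) 1 (fun t : R => complex.Im (E t a b)) (complex.Im (D a b))].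
  exists (fun t => expm (- Gtheta Gs th + t%:C *: (- Gs i))); split.
  - by move=> t; rewrite Gtheta_shift.
  - by rewrite scale0r addr0.
  - by move=> a b; exact: is_derive_expm (hD a b).
(* The partition function is real and positive at every shifted parameter, so dividing by it is a
   real scaling, and the quotient rule applies separately to real and imaginary parts. *)
have [Z trE Z_gt0] : exists2 Z : R -> R, forall t, \tr (E t) = (Z t)%:C & forall t, 0 < Z t.
  exists (fun t => complex.Re (\tr (E t))) => t;
    have [w trw w0] := expm_herm_trace (herm_opN (herm_Gtheta (Defs.shift th i t)));
    rewrite -EE trw; [by []|exact: w0].
have Z0 : Z 0 = z by apply: complexI; rewrite -trE E0.
have Zn : Z 0 != 0 by rewrite gt_eqF.
have dZ : is_derive (0 : R) 1 Z (complex.Re (\tr D)).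
  have -> : Z = \sum_a (fun t => complex.Re (E t a a)).
    by apply/funext => t; rewrite fct_sumE -complex_Re_sum -/(mxtrace (E t)) trE.
  rewrite /mxtrace complex_Re_sum; apply: is_derive_sum => a.
  exact: (dE a a).1.
have gE t a b : gibbs Gs (Defs.shift th i t) a b = ((Z t)^-1)%:C * E t a b.
  by rewrite /gibbs mxE EE trE fmorphV.
have RE a b : (fun t => complex.Re (gibbs Gs (Defs.shift th i t) a b)) =
    (fun t => (Z t)^-1 * complex.Re (E t a b)).
  by apply/funext => t; rewrite gE complex_ReZ.
have IE a b : (fun t => complex.Im (gibbs Gs (Defs.shift th i t) a b)) =
    (fun t => (Z t)^-1 * complex.Im (E t a b)).
  by apply/funext => t; rewrite gE complex_ImZ.
apply/matrixP => a b; rewrite -E0 [LHS]mxE RE IE.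
rewrite (derive1_ratio Zn dZ (dE a b).1) (derive1_ratio Zn dZ (dE a b).2) Z0.
have -> (x y : C) (A B : 'M[C]_n) : (x *: A - y *: B) a b = x * A a b - y * B a b.
  by rewrite !mxE.
apply/eqP; rewrite eq_complex !complex_ReD !complex_ImD !complex_ReN !complex_ImN.
by rewrite !complex_ReZ !complex_ImZ !eqxx.
Qed.

End GibbsDerivative.

(** Factoring out exp((x+y)/2) leaves 2 sinh u over x - y on one side and 2 cosh u on the other,
    with u = (x-y)/2. *)
Lemma expR_dd_tanhc (R : realType) (x y : R) :
  expR_dd x y = (expR x + expR y) * tanhc (x - y).
Proof.
rewrite /expR_dd /tanhc subr_eq0; case: eqVneq => [->|xy]; first by lra.
have xy0 : x - y != 0 by rewrite subr_eq0.
pose u := (x - y) / 2; pose m := (x + y) / 2.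
have -> : expR x = expR u * expR m by rewrite -expRD; congr expR; rewrite /u /m; lra.
have -> : expR y = expR (- u) * expR m by rewrite -expRD; congr expR; rewrite /u /m; lra.
rewrite /tanhR /sinhR /coshR -/u; field.
by rewrite xy0 gt_eqF// addr_gt0// expR_gt0.
Qed.

Lemma mxtrace_mul_real_diag (R : realType) (n : nat) (A : 'M[R[i]]_n) (lam : 'I_n -> R) :
  \tr (A *m real_diag lam) = \sum_k A k k * (lam k)%:C.
Proof. by apply: eq_bigr => k _; rewrite mul_mx_diag !mxE. Qed.

Lemma mulmx_conj (R : realType) (n : nat) (U A B : 'M[R[i]]_n) : unitary_op U ->
  (U *m A *m adjoint U) *m (U *m B *m adjoint U) = U *m (A *m B) *m adjoint U.
Proof. by move=> [UU _]; rewrite !mulmxA -(mulmxA _ (adjoint U) U) UU mulmx1. Qed.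

Lemma mxtrace_anticomm_conj (R : realType) (n : nat) (U A B L P Q r : 'M[R[i]]_n) :
  unitary_op U -> P = U *m A *m adjoint U -> Q = U *m B *m adjoint U ->
  r = U *m L *m adjoint U ->
  \tr ((P *m Q + Q *m P) *m r) = \tr ((A *m B + B *m A) *m L).
Proof.
move=> hU -> -> ->; rewrite !mulmx_conj// -mulmxDl -mulmxDr mulmx_conj//.
exact: mxtrace_conj.
Qed.

(** Off the diagonal the product reduces to [F], since one factor lam_k + lam_l cancels. On the
    diagonal it is lam_k (A_kk - c)(B_kk - d), whose excess over [F] is [K]. As the lam_k sum to 1,
    the [K k] sum to cd - dc - cd = -cd. *)
Lemma fisher_sum (R : realType) (n : nat) (lam : 'I_n -> R) (A B : 'M[R[i]]_n)
    (c d : R[i]) :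
  (forall k, 0 < lam k) -> \sum_k (lam k)%:C = 1 :> R[i] ->
  \tr (A *m real_diag lam) = c -> \tr (B *m real_diag lam) = d ->
  \sum_k \sum_l (2 / (lam k + lam l))%:C
    * (- ((lam k + lam l) / 2)%:C * A k l + ((lam k)%:C * c) *+ (k == l))
    * (- ((lam l + lam k) / 2)%:C * B l k + ((lam l)%:C * d) *+ (l == k)) =
  (1 / 2)%:C * \tr ((A *m B + B *m A) *m real_diag lam) - c * d.
Proof.
move=> lam0 lam1 trA trB.
pose F k l : R[i] := (1 / 2)%:C * ((lam k)%:C + (lam l)%:C) * (A k l * B l k).
pose K k : R[i] := c * d * (lam k)%:C - d * (A k k * (lam k)%:C) - c * (B k k * (lam k)%:C).
transitivity (\sum_k \sum_l (F k l + K k *+ (k == l))).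
  apply: eq_bigr => k _; apply: eq_bigr => l _.
  have s0 : (lam k)%:C + (lam l)%:C != 0 :> R[i].
    by rewrite -rmorphD fmorph_eq0 gt_eqF// addr_gt0.
  have two0 : (2 : R[i]) != 0 by rewrite pnatr_eq0.
  have -> : (2 / (lam k + lam l))%:C = 2 / ((lam k)%:C + (lam l)%:C) :> R[i].
    by rewrite fmorph_div rmorph_nat rmorphD.
  have half x y : ((x + y) / 2)%:C = (x%:C + y%:C) / 2 :> R[i].
    by rewrite fmorph_div rmorph_nat rmorphD.
  rewrite !half /F fmorph_div rmorph1 rmorph_nat eq_sym.
  case: (eqVneq l k) s0 => [->|_] s0; last by rewrite /= !mulr0n; field; rewrite s0.
  have lk0 : (lam k)%:C != 0 :> R[i] by rewrite fmorph_eq0 gt_eqF.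
  rewrite /K !mulr1n; move: (lam k)%:C lk0 s0 (A k k) (B k k) => x x0 s0 p q.
  by field.
under eq_bigr do rewrite big_split/=.
rewrite big_split/=; congr (_ + _).
  rewrite mxtrace_mul_real_diag mulr_sumr.
  transitivity (\sum_k \sum_l ((1 / 2)%:C * (A k l * B l k * (lam k)%:C) +
                               (1 / 2)%:C * (A k l * B l k * (lam l)%:C)) : R[i]).
    by apply: eq_bigr => k _; apply: eq_bigr => l _; rewrite /F; ring.
  under eq_bigr do rewrite big_split/=.
  rewrite big_split/= [X in _ + X]exchange_big/= -big_split/=.
  apply: eq_bigr => k _; rewrite !mxE mulrDl mulrDr !mulr_suml !mulr_sumr.
  by congr (_ + _); apply: eq_bigr => l _; rewrite (mulrC (B k l)).
transitivity (\sum_k K k).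
  apply: eq_bigr => k _; rewrite (bigD1 k)//= eqxx big1 ?addr0// => l /negPf lk.
  by rewrite eq_sym lk.
rewrite /K !sumrB -!mulr_sumr lam1 -!mxtrace_mul_real_diag trA trB.
by ring.
Qed.

(** Transfers everything to the given eigenbasis, where [A i] is the matrix of Phi(G_i). Phi fixes
    diagonal entries there, because its multiplier at frequency 0 is the mass 1; hence G_i and
    Phi(G_i) have the same expectation in the state. *)
Lemma gibbs_spectral_data (R : realType) (n J : nat) (Gs : 'I_J -> 'M[R[i]]_n)
  (th : 'I_J -> R) (U : 'M[R[i]]_n) (lam : 'I_n -> R) :
  (0 < n)%N -> (forall j, herm_op (Gs j)) -> unitary_op U -> (forall k, 0 < lam k) ->
  gibbs Gs th = U *m real_diag lam *m adjoint U ->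
  \sum_k (lam k)%:C = 1 :> R[i] /\
  exists A : 'I_J -> 'M[R[i]]_n,
  [/\ forall i, Phi (Gtheta Gs th) (Gs i) = U *m A i *m adjoint U,
      forall i, \tr (Gs i *m gibbs Gs th) = \tr (A i *m real_diag lam) &
      forall i k l, (adjoint U *m pderiv (gibbs Gs) i th *m U) k l =
        - ((lam k + lam l) / 2)%:C * A i k l +
        ((lam k)%:C * \tr (A i *m real_diag lam)) *+ (k == l)].
Proof.
move=> n0 hGs hU lam0 rhoE; have [UU1 UU2] := hU.
have hG := herm_Gtheta hGs th.
have [z trz /(_ n0) z0] := expm_herm_trace (herm_opN hG).
have zC : z%:C != 0 :> R[i] by rewrite fmorph_eq0 gt_eqF.
have expG : expm (- Gtheta Gs th) = U *m real_diag (fun k => z * lam k) *m adjoint U.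
  have -> : expm (- Gtheta Gs th) = z%:C *: gibbs Gs th.
    by rewrite /gibbs trz scalerA divff// scale1r.
  rewrite rhoE scalemxAl scalemxAr; congr (_ *m _ *m _).
  by apply/matrixP => p q; rewrite !mxE rmorphM/= mulrnAr.
have zlam0 k : 0 < z * lam k by rewrite mulr_gt0.
have GE := herm_op_log_diag hG hU zlam0 expG.
(* These are the eigenvalues of -G; the frequency (-a_l) - (-a_k) in [Phi] is therefore a_k -
   a_l. *)
pose a k := ln (z * lam k).
have NGE : - Gtheta Gs th = U *m real_diag a *m adjoint U.
  rewrite GE -mulNmx -mulmxN; congr (_ *m _ *m _).
  by apply/matrixP => p q; rewrite !mxE rmorphN mulNrn opprK.
have expa k : expR (a k) = z * lam k by rewrite lnK// posrE.
pose H i := adjoint U *m Gs i *m U.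
have HE i' : Gs i' = U *m H i' *m adjoint U.
  by rewrite /H !mulmxA UU2 mul1mx -mulmxA UU2 mulmx1.
have unconj (M : 'M[R[i]]_n) : adjoint U *m (U *m M *m adjoint U) *m U = M.
  by rewrite !mulmxA UU1 mul1mx -mulmxA UU1 mulmx1.
have Hreal i' k : H i' k k = (complex.Re (H i' k k))%:C.
  have : adjoint (H i') = H i' by rewrite /H !adjointM adjointK hGs mulmxA.
  move/matrixP/(_ k k); rewrite 2!mxE; case: (H i' k k) => x y /= [] yN.
  by congr (_ +i* _); lra.
pose A i' : 'M[R[i]]_n := \matrix_(k, l) ((2 * tanhc (a k - a l))%:C * H i' k l).
split.
  have <- : \tr (real_diag lam) = \sum_k (lam k)%:C by rewrite mxtrace_real_diag rmorph_sum.
  rewrite -(mxtrace_conj _ hU).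
  by rewrite -rhoE /gibbs mxtraceZ trz mulVf.
exists A.
have PhiE i' : Phi (Gtheta Gs th) (Gs i') = U *m A i' *m adjoint U.
  rewrite GE (Phi_spectral _ _ hU).
  have -> : A i' = \matrix_(k, l) ((2 * tanhc (- a l - - a k))%:C * H i' k l).
    by apply/matrixP => k l; rewrite [LHS]mxE [RHS]mxE opprK addrC.
  by [].
have tanhc0 : 2 * tanhc 0 = 1 :> R by rewrite /tanhc eqxx; lra.
have trAE i' : \tr (Gs i' *m gibbs Gs th) = \tr (A i' *m real_diag lam).
  rewrite rhoE HE mulmx_conj//.
  rewrite mxtrace_conj// !mxtrace_mul_real_diag; apply: eq_bigr => k _.
  by rewrite [A i' k k]mxE subrr tanhc0 mul1r.
have dE i' k l : (adjoint U *m pderiv (gibbs Gs) i' th *m U) k l =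
    - ((lam k + lam l) / 2)%:C * A i' k l +
    ((lam k)%:C * \tr (A i' *m real_diag lam)) *+ (k == l).
  (* The derivative of exp(-G) in the direction -G_i, written in the eigenbasis. *)
  pose D' : 'M[R[i]]_n := \matrix_(p, q) ((- H i') p q * (expR_dd (a p) (a q))%:C).
  have NGs : - Gs i' = U *m (- H i') *m adjoint U by rewrite HE mulmxN mulNmx.
  have cD p q : ccvg (fact_sum (fun k => dpow (- Gtheta Gs th) (- Gs i') k p q))
      ((U *m D' *m adjoint U) p q).
    by rewrite NGE NGs; exact: ccvg_dpow.
  rewrite (pderiv_gibbs hGs n0 cD trz).
  have trD : \tr (U *m D' *m adjoint U) = - (z%:C * \tr (A i' *m real_diag lam)).
    rewrite mxtrace_conj// mxtrace_mul_real_diag mulr_sumr -sumrN.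
    apply: eq_bigr => p _; rewrite [D' p p]mxE [(- H i') p p]mxE [A i' p p]mxE.
    rewrite subrr tanhc0 /expR_dd eqxx expa rmorphM mul1r.
    by ring.
  (* [pderiv_gibbs] involves only a real part of the trace; the trace is real because the diagonal
     of a Hermitian matrix is. *)
  have trReal : \tr (A i' *m real_diag lam) =
      (complex.Re (\tr (A i' *m real_diag lam)))%:C.
    rewrite mxtrace_mul_real_diag.
    have -> : \sum_p A i' p p * (lam p)%:C =
        (\sum_p (2 * tanhc (a p - a p) * complex.Re (H i' p p) * lam p))%:C.
      by rewrite rmorph_sum; apply: eq_bigr => p _; rewrite [A i' p p]mxE {1}Hreal -!rmorphM.
    by [].
  rewrite expG -/(real_diag _).
  have -> : (z^-1)%:C *: (U *m D' *m adjoint U) - (complex.Re (\tr (U *m D' *m adjoint U)) / z ^+ 2)%:C *: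
      (U *m real_diag (fun k => z * lam k) *m adjoint U) =
      U *m ((z^-1)%:C *: D' - (complex.Re (\tr (U *m D' *m adjoint U)) / z ^+ 2)%:C *:
        real_diag (fun k => z * lam k)) *m adjoint U.
    by rewrite mulmxBr mulmxBl -!scalemxAr -!scalemxAl.
  rewrite unconj trD trReal.
  move: (complex.Re (\tr (A i' *m real_diag lam))) => c.
  have -> : complex.Re (- (z%:C * c%:C)) = - (z * c) by rewrite -rmorphM -rmorphN.
  have -> : ((z^-1)%:C *: D' - (- (z * c) / z ^+ 2)%:C *: real_diag (fun k => z * lam k)) k l =
      (z^-1)%:C * D' k l - (- (z * c) / z ^+ 2)%:C * (real_diag (fun k => z * lam k)) k l.
    by rewrite [LHS]mxE [X in X + _]mxE [X in _ + X]mxE [X in - X]mxE.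
  congr (_ + _).
    rewrite [D' k l]mxE [(- H i') k l]mxE [A i' k l]mxE expR_dd_tanhc !expa.
    move: (tanhc _) (H i' k l) => t h.
    have E : z^-1 * ((z * lam k + z * lam l) * t) = (lam k + lam l) / 2 * (2 * t).
      by field; rewrite gt_eqF.
    by rewrite [in RHS]mulrA [in RHS]mulNr -[in RHS]rmorphM -E rmorphM; ring.
  rewrite [real_diag _ k l]mxE mxE; case: eqVneq => _; last by rewrite !mulr0n mulr0 oppr0.
  rewrite !mulr1n -!rmorphM -rmorphN; congr (_%:C).
  by field; rewrite gt_eqF.
by split.
Qed.

(** The spectral decomposition is arbitrary, so the formula covers every choice of eigenbasis in the
    Fisher--Bures sum. *)
Theorem theorem1 (R : realType) (n J : nat) (Gs : 'I_J -> 'M[R[i]]_n)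
  (th : 'I_J -> R) (U : 'M[R[i]]_n) (lam : 'I_n -> R) :
  (forall j, herm_op (Gs j)) ->
  unitary_op U ->
  (forall k, 0 < lam k) ->
  gibbs Gs th = U *m diag_mx (\row_k (lam k)%:C) *m adjoint U ->
  forall i j : 'I_J,
    fisher_bures (gibbs Gs) th U lam i j =
      (1 / 2)%:C
        * \tr ((Phi (Gtheta Gs th) (Gs i) *m Phi (Gtheta Gs th) (Gs j)
                + Phi (Gtheta Gs th) (Gs j) *m Phi (Gtheta Gs th) (Gs i))
               *m gibbs Gs th)
      - \tr (Gs i *m gibbs Gs th) * \tr (Gs j *m gibbs Gs th).
Proof.
move=> hGs hU lam0 gibbsE i j.
(* In dimension 0 the state cannot have trace 1, but both sides are empty sums. *)
have [n0|] := ltnP 0 n; last first.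
  rewrite leqn0 => /eqP n0; case: _ / (esym n0) in Gs U lam hGs hU lam0 gibbsE *.
  by rewrite /fisher_bures /mxtrace !big_ord0 !mulr0 subr0.
have [sum_lam [A [PhiE trE dE]]] := gibbs_spectral_data n0 hGs hU lam0 gibbsE.
rewrite (mxtrace_anticomm_conj hU (PhiE i) (PhiE j) gibbsE) (trE i) (trE j).
rewrite -(fisher_sum lam0 sum_lam erefl erefl) /fisher_bures.
apply: eq_bigr => k _; apply: eq_bigr => l _.
exact: (congr2 (fun x y => (2 / (lam k + lam l))%:C * x * y) (dE i k l) (dE j l k)).
Qed.
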